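(* Let $\Omega\subset\mathbb{R}^d$ be a measurable set with $0<|\Omega|<+\infty$, let $\Lambda\subset\mathbb{R}^d$ be a full lattice with dual lattice $H$, and let $k$ be a positive integer. Suppose that (i) $\Omega$ multi-tiles $\mathbb{R}^d$ at level $k$ by translations on $\Lambda$, and (ii) $\Omega$ is admissible for $\Lambda$. Then there exist $a_1,\dots,a_k\in\mathbb{R}^d$ such that $E(H;a_1,\dots,a_k)$ is a Riesz basis of $L^2(\Omega)$.
   Context: A full lattice in $\mathbb{R}^d$ is a set $\Lambda=M\mathbb{Z}^d$ with $M$ an invertible real $d\times d$ matrix; its fundamental domain is $D=M[0,1)^d$, and its dual lattice is $H=\{h\in\mathbb{R}^d:\langle h,\lambda\rangle\in\mathbb{Z}\text{ for all }\lambda\in\Lambda\}$. For $\Omega\subset\mathbb{R}^d$ and $\omega\in D$, put $\Lambda_\omega=\{\lambda\in\Lambda:\omega+\lambda\in\Omega\}$. $\Omega$ multi-tiles $\mathbb{R}^d$ at level $k$ by translations on $\Lambda$ if $\sum_{\lambda\in\Lambda}\chi_\Omega(\omega+\lambda)=k$ for almost every $\omega\in D$. $\Omega$ (of finite measure) is admissible for $\Lambda$ if there exist $v\in H$ and a positive integer $n$ such that for almost every $\omega\in D$ the integers $\langle v,\lambda\rangle$, $\lambda\in\Lambda_\omega$, are pairwise distinct modulo $n$ (i.e. $\langle v,\lambda\rangle\not\equiv\langle v,\lambda'\rangle \pmod n$ for distinct $\lambda,\lambda'\in\Lambda_\omega$). $E(H;a_1,\dots,a_k)$ is the system of functions $\omega\mapsto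 e^{2\pi i(a_j+h)\cdot\omega}$ (restricted to $\Omega$), regarded as a family indexed by $h\in H$, $j=1,\dots,k$. A countable family $\{f_\gamma\}_{\gamma\in\Gamma}$ in $L^2(\Omega)$ is a Riesz basis if it is complete (its linear span is dense) and there are constants $A,B>0$ with $A\sum_\gamma|c_\gamma|^2\le\|\sum_\gamma c_\gamma f_\gamma\|^2_{L^2(\Omega)}\le B\sum_\gamma|c_\gamma|^2$ for all $\{c_\gamma\}\in\ell^2(\Gamma)$. *)

(* Defs.v *)
From HB Require Import structures.
From mathcomp Require Import all_boot all_order all_algebra finmap.
From mathcomp Require Import all_classical all_reals all_analysis.
From mathcomp Require complex.

Set Implicit Arguments.
Unset Strict Implicit.
Unset Printing Implicit Defensive.
Import Order.TTheory GRing.Theory Num.Theory.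
Import numFieldNormedType.Exports.

Local Open Scope classical_set_scope.
Local Open Scope ring_scope.

(* The library has Lebesgue measure on R and binary product measures only.
   Borel-Lebesgue measure on n-tuples is built by recursion on n; its outer
   measure is transported to column vectors, and Caratheodory's construction
   then gives the (complete) Lebesgue measure on the Lebesgue measurable
   subsets of R^n. *)
Section lebesgue_tuple_cons.
Context {R : realType} (n : nat).
Local Notation RT := (measurableTypeR R).

Definition tuple_cons (p : n.-tuple RT * RT) : n.+1.-tuple RT :=
  [the n.+1.-tuple RT of p.2 :: p.1].

Lemma measurable_tuple_cons : measurable_fun [set: _] tuple_cons.
Proof. exact: measurable_cons. Qed.

Variable m : {measure set (n.-tuple RT) -> \bar R}.

Definition lebesgue_tuple_cons : set (n.+1.-tuple RT) -> \bar R :=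
  pushforward (m \x lebesgue_measure)%E tuple_cons.

Let m0 : lebesgue_tuple_cons set0 = 0%E.
Proof. by rewrite /lebesgue_tuple_cons /pushforward preimage_set0 measure0. Qed.

Let m_ge0 A : (0 <= lebesgue_tuple_cons A)%E.
Proof. exact: (measure_ge0 (m \x lebesgue_measure)%E). Qed.

Let m_sigma_additive : semi_sigma_additive lebesgue_tuple_cons.
Proof.
have mf := measurable_tuple_cons.
move=> F mF tF mUF; rewrite /lebesgue_tuple_cons /pushforward preimage_bigcup.
apply: measure_semi_sigma_additive.
- by move=> i; rewrite -[X in measurable X]setTI; exact: mf.
- apply/trivIsetP => /= i j _ _ ij; rewrite -preimage_setI.
  by move/trivIsetP : tF => /(_ _ _ _ _ ij) ->//; rewrite preimage_set0.
- by rewrite -preimage_bigcup -[X in measurable X]setTI; exact: mf.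
Qed.

HB.instance Definition _ := isMeasure.Build _ _ _ lebesgue_tuple_cons
  m0 m_ge0 m_sigma_additive.

End lebesgue_tuple_cons.

Fixpoint lebesgue_tuple (R : realType) (n : nat) :
    {measure set (n.-tuple (measurableTypeR R)) -> \bar R} :=
  match n with
  | 0 => dirac ([tuple] : 0.-tuple (measurableTypeR R))
  | n'.+1 => lebesgue_tuple_cons (lebesgue_tuple R n')
  end.

Section lebesgue_outer.
Context (R : realType) (d : nat).

Definition col_of_tuple (t : d.-tuple R) : 'cV[R]_d := \col_i tnth t i.

Definition lebesgue_outer (A : set 'cV[R]_d) : \bar R :=
  ((lebesgue_tuple R d)^*)%mu (col_of_tuple @^-1` A).

Let lebesgue_outer0 : lebesgue_outer set0 = 0%E.
Proof. by rewrite /lebesgue_outer preimage_set0 outer_measure0. Qed.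

Let lebesgue_outer_ge0 A : (0 <= lebesgue_outer A)%E.
Proof. exact: outer_measure_ge0. Qed.

Let le_lebesgue_outer : {homo lebesgue_outer : A B / A `<=` B >-> (A <= B)%E}.
Proof. by move=> A B AB; apply: le_outer_measure => t; exact: AB. Qed.

Let lebesgue_outer_sigma_subadditive : sigma_subadditive lebesgue_outer.
Proof.
by move=> F; rewrite /lebesgue_outer preimage_bigcup;
  exact: outer_measure_sigma_subadditive.
Qed.

HB.instance Definition _ := isOuterMeasure.Build R 'cV[R]_d lebesgue_outer
  lebesgue_outer0 lebesgue_outer_ge0 le_lebesgue_outer
  lebesgue_outer_sigma_subadditive.

(* 'cV[R]_d with the sigma-algebra of Lebesgue measurable sets *)
Definition euclid := caratheodory_type lebesgue_outer.
HB.instance Definition _ := Measurable.on euclid.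

Definition leb : set euclid -> \bar R := lebesgue_outer.

Let leb0 : leb set0 = 0%E. Proof. exact: caratheodory_measure0. Qed.

Let leb_ge0 A : (0 <= leb A)%E. Proof. exact: caratheodory_measure_ge0. Qed.

Let leb_sigma_additive : semi_sigma_additive leb.
Proof. exact: caratheodory_measure_sigma_additive. Qed.

HB.instance Definition _ := isMeasure.Build _ _ _ leb
  leb0 leb_ge0 leb_sigma_additive.

End lebesgue_outer.
Arguments leb {R d}.

Section lattices.
Context (R : realType) (d : nat).
Implicit Types (M : 'M[R]_d) (L : set 'cV[R]_d).

Definition dot (x y : 'cV[R]_d) : R := \sum_i x i 0 * y i 0.

(* M Z^d; a full lattice when M is invertible *)
Definition lattice M : set 'cV[R]_d :=
  [set M *m map_mx intr z | z in [set: 'cV[int]_d]].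

(* M [0,1)^d *)
Definition fund_domain M : set 'cV[R]_d :=
  [set M *m t | t in [set t : 'cV[R]_d | forall i, 0 <= t i 0 < 1]].

Definition dual_lattice L : set 'cV[R]_d :=
  [set h | forall l, L l -> dot h l \is a Num.int].

Definition lattice_section M (Omega : set 'cV[R]_d) (w : 'cV[R]_d) :
    set 'cV[R]_d :=
  [set l | lattice M l /\ Omega (w + l)].

Definition multi_tiles M (Omega : set (euclid R d)) (k : nat) : Prop :=
  {ae leb, forall w : 'cV[R]_d, fund_domain M w ->
    (\esum_(l in lattice M) (\1_Omega (w + l)%R : R)%:E = k%:R%:E)%E}.

Definition admissible M (Omega : set (euclid R d)) : Prop :=
  exists (v : 'cV[R]_d) (n : nat),
    [/\ dual_lattice (lattice M) v, (0 < n)%N &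
      {ae leb, forall w : 'cV[R]_d, fund_domain M w ->
        forall l l', lattice_section M Omega w l ->
          lattice_section M Omega w l' -> l <> l' ->
          forall p q : int, dot v l = p%:~R -> dot v l' = q%:~R ->
            (p <> q %[mod n])%Z}].

End lattices.

Section riesz_basis.
Import complex.
Context (R : realType) (d : nat).
Implicit Types (Omega : set (euclid R d)) (f S : euclid R d -> R[i]).

(* |z|^2 as an element of R *)
Definition sqmod (z : R[i]) : R := Normc.normc z ^+ 2.

Definition sqnormL2 Omega f : \bar R :=
  (\int[leb]_(x in Omega) (sqmod (f x))%:E)%E.

(* Functions on R^d stand for their restrictions to Omega. *)
Definition inL2 Omega f : Prop :=
  [/\ measurable_fun Omega (fun x => complex.Re (f x)),
      measurable_fun Omega (fun x => complex.Im (f x)) &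
      (sqnormL2 Omega f < +oo)%E].

Context (I : choiceType).
Implicit Types (e : I -> euclid R d -> R[i]) (c : I -> R[i]).

Definition fin_comb e c (F : {fset I}) : euclid R d -> R[i] :=
  fun x => \sum_(g <- F) c g * e g x.

(* S = \sum_g c_g e_g with unconditional convergence in L^2(Omega) *)
Definition sumL2 Omega e c S : Prop :=
  forall eps : R, 0 < eps -> exists F0 : {fset I}, forall F : {fset I},
    (F0 `<=` F)%fset ->
    (sqnormL2 Omega (fun x => (S x - fin_comb e c F x)%R) < eps%:E)%E.

Definition sqnorml2 c : \bar R := (\esum_(g in [set: I]) (sqmod (c g))%:E)%E.

Definition completeL2 Omega e : Prop :=
  forall f, inL2 Omega f -> forall eps : R, 0 < eps ->
    exists (F : {fset I}) (c : I -> R[i]),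
      (sqnormL2 Omega (fun x => (f x - fin_comb e c F x)%R) < eps%:E)%E.

Definition riesz_basis Omega e : Prop :=
  [/\ countable [set: I],
      forall g, inL2 Omega (e g),
      completeL2 Omega e &
      exists A B : R, [/\ 0 < A, 0 < B &
        forall c, (sqnorml2 c < +oo)%E ->
          exists S, [/\ inL2 Omega S, sumL2 Omega e c S,
            (A%:E * sqnorml2 c <= sqnormL2 Omega S)%E &
            (sqnormL2 Omega S <= B%:E * sqnorml2 c)%E]]].

End riesz_basis.

Section exponentials.
Import complex.
Context (R : realType) (d : nat).

(* e^{2 pi i t} *)
Definition expi2pi (t : R) : R[i] :=
  Complex (cos (2 * pi * t)) (sin (2 * pi * t)).

Definition exp_system (H : set 'cV[R]_d) (k : nat) (a : 'I_k -> 'cV[R]_d)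
    (g : H * 'I_k) : euclid R d -> R[i] :=
  fun w => expi2pi (dot (a g.2 + val g.1) w).

End exponentials.

(* Main.v *)
(* Fold L^2(Omega) over the fundamental domain D: the periodization formula
   turns an integral over Omega into the integral over D of the sum over the
   points w + l of Omega. Take a_j = (j/n) v for j < k. On the fibre above w
   the combination sum_j sum_h c_(j,h) e_(a_j+h) takes the values
   sum_j q_j(w) z^j, where z ranges over k distinct n-th roots of unity and
   the modulus of q_j is that of sum_h c_(j,h) e_h. The q_j and the values on
   the fibre determine each other through Lagrange interpolation at these
   roots, with constants that are uniform in w since there are finitely many
   sets of roots; together with the orthogonality of the e_h on D this gives
   both Riesz bounds.
   For completeness, the bounded functions w such that multiplication by w
   preserves the closed span form an algebra that is stable under bounded
   pointwise limits and contains the e_h, hence contains every bounded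
   measurable periodic function; interpolating with such coefficients yields
   the indicators of measurable subsets of Omega. *)

Require Import Defs.
From HB Require Import structures.
From mathcomp Require Import all_boot all_order all_algebra finmap.
From mathcomp Require Import all_classical all_reals all_analysis.
From mathcomp Require Import measurable_realfun.
From mathcomp Require complex.
From mathcomp Require Import ring lra.

Set Implicit Arguments.
Unset Strict Implicit.
Unset Printing Implicit Defensive.
Import Order.TTheory GRing.Theory Num.Theory.
Import numFieldNormedType.Exports.

Local Open Scope classical_set_scope.
Local Open Scope ring_scope.

(** * Translation invariance of Lebesgue measure *)

(** The choice of [a_j] is dictated by admissibility: at a lattice point [l] the character of [h] is
    1, while that of [(j/n) v] is the [j]-th power of a root of unity that depends only on [<v,l>]
    modulo [n]. Distinct residues give distinct nodes and multi-tiling gives exactly [k] of them, so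
    each fibre carries a square Vandermonde system. Norms are kept squared throughout, and
    [|z+w|^2 <= 2(|z|^2+|w|^2)] stands in for the triangle inequality; hence the factors 2 in the
    final constants. Orthogonality on [D] comes from a translation by half a period, and finiteness
    of [|D|] from [|Omega| = k|D|], so no linear change of variables by [M] enters. For density, the
    coordinates of [M^-1 x] are not periodic. What is available are sines and cosines, whose sign
    conditions already determine the order on [[0,1)]; this reaches the Borel sets of [D]. A
    Lebesgue measurable subset of [D] differs from a Borel set by a null set, and the periodization
    of a null set is null. *)

Section translation.
Context {R : realType}.
Local Notation RT := (measurableTypeR R).

(** The image measure under the shift gives each half-open interval its length, and this determines
    Lebesgue measure. *)
Lemma lebesgue_measure_shift (a : R) (A : set RT) : measurable A ->
  lebesgue_measure ((fun x : RT => (a + x : RT)) @^-1` A) = lebesgue_measure A.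
Proof.
have ma : measurable_fun [set: RT] (fun x : RT => (a + x : RT)).
  exact: measurable_funD.
move=> mA; rewrite -[LHS]/(pushforward lebesgue_measure (fun x : RT => (a + x : RT)) A).
apply/esym/lebesgue_measure_unique => //= _ [[b c]] _ <-.
rewrite /pushforward.
transitivity (lebesgue_measure (`](b - a), (c - a)]%classic : set RT)); last first.
  congr lebesgue_measure.
  by apply/seteqP; split => x /=; rewrite !in_itv/= ltrBlDl lerBrDl.
rewrite !lebesgue_measure_itv/= !lte_fin ltrD2r.
by case: ifP => // _; rewrite -!EFinB opprB addrA subrK.
Qed.

Definition tuple_add n (s t : n.-tuple RT) : n.-tuple RT :=
  [tuple (tnth s i + tnth t i : R) | i < n].

Lemma measurable_tuple_add n (s : n.-tuple RT) :
  measurable_fun [set: n.-tuple RT] (tuple_add s).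
Proof.
apply/measurable_fun_tnthP => i; rewrite /comp.
under eq_fun do rewrite tnth_mktuple.
by apply: measurable_funD => //; exact: measurable_tnth.
Qed.

(** The head of the tuple is the second factor of the product. One-dimensional invariance handles
    each section; by induction the measure on tails is its own image under the shift, so the outer
    integral is unchanged too. *)
Lemma lebesgue_tuple_shift n (s : n.-tuple RT) (A : set (n.-tuple RT)) :
  measurable A -> lebesgue_tuple R n (tuple_add s @^-1` A) = lebesgue_tuple R n A.
Proof.
elim: n s A => [|n IH] s A mA.
  rewrite /= !diracE; congr ((_ : bool)%:R%:E).
  have s0 : tuple_add s [tuple] = [tuple] by exact: tuple0.
  by apply/idP/idP; rewrite !inE /= s0.
rewrite /= /lebesgue_tuple_cons /pushforward.
pose s' : n.-tuple RT := [tuple of behead s].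
have shiftE p : tuple_add s (tuple_cons p) =
    tuple_cons (tuple_add s' p.1, (thead s + p.2 : R)).
  apply: eq_from_tnth => i; rewrite tnth_mktuple.
  case: (unliftP ord0 i) => [j|] ->; last by rewrite !tnth0.
  rewrite !tnthS tnth_mktuple; congr (_ + _).
  by rewrite [in LHS](tuple_eta s) tnthS.
set B := @tuple_cons R n @^-1` A.
have mB : measurable B.
  by rewrite -[B]setTI; exact: measurable_tuple_cons.
have -> : @tuple_cons R n @^-1` (tuple_add s @^-1` A) =
  (fun p => (tuple_add s' p.1, (thead s + p.2 : RT))) @^-1` B.
  by apply/funext => p; rewrite /preimage /B /= shiftE.
have mp : measurable_fun [set: n.-tuple RT]
    (fun x => lebesgue_measure (xsection B x) : \bar R).
  exact: measurable_fun_xsection.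
rewrite /product_measure1.
transitivity (\int[lebesgue_tuple R n]_x
    lebesgue_measure (xsection B (tuple_add s' x)))%E.
  apply: eq_integral => x _ /=.
  rewrite -[RHS](lebesgue_measure_shift (thead s)).
    by congr lebesgue_measure.
  exact: measurable_xsection.
transitivity (\int[pushforward (lebesgue_tuple R n) (tuple_add s')]_x
    lebesgue_measure (xsection B x))%E.
  rewrite (@ge0_integral_pushforward _ _ _ _ _ _ (measurable_tuple_add s')
    (lebesgue_tuple R n) setT (fun x => lebesgue_measure (xsection B x))) //.
rewrite (eq_measure_integral (lebesgue_tuple R n)) //.
  exact: measurable_tuple_add.
by move=> mg C mC _; exact: IH.
Qed.
End translation.

(** * Lebesgue measure on column vectors: translations, Borel sets, Borel hulls *)

Section lebesgue_euclid.
Context (R : realType) (d : nat).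
Local Notation RT := (measurableTypeR R).
Local Notation V := 'cV[R]_d.
Local Notation E := (euclid R d).
Implicit Types (A : set V) (t : V).

Definition tuple_of_col t : d.-tuple RT := [tuple t i 0 : R | i < d].

Lemma tuple_of_colK t : col_of_tuple (tuple_of_col t) = t.
Proof. by apply/colP => i; rewrite mxE tnth_mktuple. Qed.

Lemma col_of_tupleK (s : d.-tuple R) : tuple_of_col (col_of_tuple s) = s.
Proof. by apply: eq_from_tnth => i; rewrite tnth_mktuple mxE. Qed.

Lemma col_of_tuple_add t (s : d.-tuple R) :
  col_of_tuple (tuple_add (tuple_of_col t) s) = t + col_of_tuple s.
Proof. by apply/colP => i; rewrite !mxE !tnth_mktuple. Qed.

(** A shifted countable measurable cover covers the shifted set with the same total measure. *)
Lemma mu_ext_shift_le t (X : set (d.-tuple RT)) :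
  (((lebesgue_tuple R d)^*)%mu (tuple_add (tuple_of_col t) @^-1` X) <=
   ((lebesgue_tuple R d)^*)%mu X)%E.
Proof.
apply: le_ereal_inf_tmp => _ [F [mF XF] <-].
set g := tuple_add _.
have mg i : measurable (g @^-1` F i).
  by rewrite -[X in measurable X]setTI; exact: measurable_tuple_add.
apply: ereal_inf_lbound; exists (fun i => g @^-1` F i).
  by split=> // x /XF[i _ Fi]; exists i.
by apply: eq_eseriesr => i _; rewrite lebesgue_tuple_shift.
Qed.

Lemma lebesgue_outer_shift t A :
  lebesgue_outer [set x | A (t + x)] = lebesgue_outer A.
Proof.
have le (s : V) (B : set V) : (lebesgue_outer [set x | B (s + x)%R] <= lebesgue_outer B)%E.
  rewrite [leLHS](_ : _ = ((lebesgue_tuple R d)^*)%mu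
    (tuple_add (tuple_of_col s) @^-1` (@col_of_tuple R d @^-1` B))).
    exact: mu_ext_shift_le.
  rewrite /lebesgue_outer; congr (((lebesgue_tuple R d)^*)%mu _).
  by apply/funext => u; rewrite /preimage /mkset col_of_tuple_add.
apply/eqP; rewrite eq_le le /=.
(* The reverse inequality is the same one for the opposite shift. *)
apply: le_trans (le (- t) _).
by apply: le_outer_measure => x /=; rewrite addNKr.
Qed.

Lemma measurable_caratheodory (A : set E) :
  measurable A <-> forall X, lebesgue_outer X =
    (lebesgue_outer (X `&` A) + lebesgue_outer (X `&` ~` A))%E.
Proof. by []. Qed.

Lemma measurable_shift t (A : set E) : measurable A ->
  measurable ([set x : V | A (t + x)] : set E).
Proof.
move=> mA; apply/measurable_caratheodory => X.
have mA' Y : lebesgue_outer Y =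
  (lebesgue_outer (Y `&` A) + lebesgue_outer (Y `&` ~` A))%E.
  by move/measurable_caratheodory : mA; exact.
rewrite -(lebesgue_outer_shift (- t) X) mA'.
rewrite -(lebesgue_outer_shift (- t) (X `&` _)).
rewrite -(lebesgue_outer_shift (- t) (X `&` ~` _)).
congr (_ + _)%E; congr lebesgue_outer;
  by apply/funext => x; rewrite /setI /setC /= /mkset addNKr.
Qed.

Lemma leb_shift t (A : set E) : leb ([set x : V | A (t + x)] : set E) = leb A.
Proof. exact: lebesgue_outer_shift. Qed.

Lemma borel_measurable (A : set E) :
  measurable (@col_of_tuple R d @^-1` A : set (d.-tuple RT)) -> measurable A.
Proof.
move=> mA; apply/measurable_caratheodory => X; rewrite /lebesgue_outer.
exact: (@caratheodory_measurable_mu_ext _ _ _ (lebesgue_tuple R d) _ mA).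
Qed.

Lemma measurable_tuple_of_col :
  measurable_fun [set: E] (tuple_of_col : E -> d.-tuple RT).
Proof.
move=> _ A mA; rewrite setTI; apply: borel_measurable.
rewrite (_ : _ @^-1` _ = A) //; apply/funext => s.
by rewrite /preimage /mkset col_of_tupleK.
Qed.

Lemma measurable_coord i : measurable_fun [set: E] (fun x : V => x i 0 : RT).
Proof.
rewrite (_ : (fun _ => _) = (fun s : d.-tuple RT => tnth s i) \o tuple_of_col).
  apply: measurableT_comp; [exact: measurable_tnth|exact: measurable_tuple_of_col].
by apply/funext => x; rewrite /= tnth_mktuple.
Qed.

(** A Borel hull: Borel covers of measure at most [leb A + 1/(n+1)] are intersected. It later
    carries results on Borel sets over to Lebesgue measurable ones, up to a null set. *)
Lemma outer_cover (A : set E) : (leb A < +oo)%E ->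
  exists G : set (d.-tuple RT), [/\ measurable G,
    A `<=` tuple_of_col @^-1` G &
    leb (tuple_of_col @^-1` G : set E) = leb A].
Proof.
move=> Afin.
have lebE (G : set (d.-tuple RT)) : measurable G ->
    leb (tuple_of_col @^-1` G : set E) = lebesgue_tuple R d G.
  move=> mG; rewrite -measurable_mu_extE // /leb /lebesgue_outer.
  congr (((lebesgue_tuple R d)^*)%mu _).
  by apply/funext => s; rewrite /preimage /mkset col_of_tupleK.
have Afn : leb A \is a fin_num by rewrite ge0_fin_numE.
have H n : exists G : set (d.-tuple RT), [/\ measurable G,
    A `<=` tuple_of_col @^-1` G &
    (leb (tuple_of_col @^-1` G : set E) <= leb A + (n.+1%:R^-1)%:E)%E].
  have n0 : (0 < n.+1%:R^-1 :> R) by rewrite invr_gt0.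
  have [_ [F [mF AF] <-] Fle] := lb_ereal_inf_adherent n0 Afn.
  exists (\bigcup_k F k); split.
  - exact: bigcupT_measurable.
  - by move=> x Ax; apply: AF; rewrite /preimage /mkset tuple_of_colK.
  - rewrite lebE; last exact: bigcupT_measurable.
    apply: le_trans (ltW Fle).
    by apply: measure_sigma_subadditive => //; exact: bigcupT_measurable.
have [G HG] := choice H.
have mG : measurable (\bigcap_n G n).
  by apply: bigcapT_measurable => n; have [] := HG n.
exists (\bigcap_n G n); split => //.
  by move=> x Ax n _; have [_ + _] := HG n; exact.
apply/eqP; rewrite eq_le; apply/andP; split.
  apply/lee_addgt0Pr => e e0; near \oo => n.
  have [mGn _ Gn] := HG n.
  apply: (@le_trans _ _ (leb (tuple_of_col @^-1` G n : set E))).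
    by apply: le_outer_measure => x; exact.
  apply: le_trans Gn _; rewrite leeD2l // lee_fin ltW //.
  by near: n; exact: near_infty_natSinv_lt (PosNum e0).
by apply: le_outer_measure => x Ax n _; have [_ + _] := HG n; exact.
Unshelve. all: by end_near. Qed.

End lebesgue_euclid.

(** * Periodization over a lattice *)

Lemma ge0_integral_preserving d (T : measurableType d) (R : realType)
    (mu : {measure set T -> \bar R}) (phi : T -> T)
    (mphi : measurable_fun setT phi) (A : set T) (f : T -> \bar R) :
  (forall B, measurable B -> mu (phi @^-1` B) = mu B) ->
  measurable A -> measurable_fun A f -> (forall x, 0 <= f x)%E ->
  (\int[mu]_(x in A) f x = \int[mu]_(x in phi @^-1` A) f (phi x))%E.
Proof.
move=> muphi mA mf f0.
rewrite -(@ge0_integral_pushforward _ _ _ _ _ _ mphi mu A f mA mf) //.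
rewrite [RHS](eq_measure_integral mu) //.
by move=> B mB _; exact: muphi.
Qed.

Section periodization.
Context (R : realType) (d : nat).
Local Notation V := 'cV[R]_d.
Local Notation E := (euclid R d).
Variable M : 'M[R]_d.
Hypothesis M_unit : M \in unitmx.
Local Notation D := (fund_domain M : set E).

Definition lat (z : 'cV[int]_d) : V := M *m map_mx intr z.
(** The integer vector [z] for which [x] lies in the cell [lat z + D]; [red x] is then the
    representative of [x] in [D] modulo the lattice. *)
Definition zfloor (x : V) : 'cV[int]_d := \col_i Num.floor ((invmx M *m x) i 0).
Definition red (x : V) : V := x - lat (zfloor x).

Lemma latticeP (l : V) : lattice M l <-> exists z, l = lat z.
Proof. by split=> [[z _ <-]|[z ->]]; exists z. Qed.

Lemma lattice_lat z : lattice M (lat z). Proof. by exists z. Qed.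

Lemma lat0 : lat 0 = 0.
Proof. by rewrite /lat map_mx0 mulmx0. Qed.

Lemma latD y z : lat (y + z) = lat y + lat z.
Proof. by rewrite /lat map_mxD mulmxDr. Qed.

Lemma latN z : lat (- z) = - lat z.
Proof. by rewrite /lat map_mxN mulmxN. Qed.

Lemma lat_inj : injective lat.
Proof.
move=> y z /(congr1 (mulmx (invmx M))); rewrite /lat !mulKmx // => /matrixP yz.
apply/matrixP => i j; have := yz i j; rewrite !mxE; exact: intr_inj.
Qed.

Lemma zfloorD x z : zfloor (x + lat z) = zfloor x + z.
Proof.
apply/colP => i; rewrite [LHS]mxE mulmxDr /lat mulKmx // !mxE.
by rewrite floorDrz ?intrKfloor // intr_int.
Qed.

Lemma red_lat x z : red (x + lat z) = red x.
Proof. by rewrite /red zfloorD latD opprD addrACA subrr addr0. Qed.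

Lemma red_lattice x l : lattice M l -> red (x + l) = red x.
Proof. by move=> /latticeP[z ->]; exact: red_lat. Qed.

Lemma zfloor_fund w : zfloor w = 0 <-> D w.
Proof.
split=> [/colP w0|[t t01 <-]].
  exists (invmx M *m w); last by rewrite mulKVmx.
  move=> i /=; have := w0 i; rewrite !mxE => /eqP.
  by rewrite floor_eq mulr0z add0r mulr1z.
apply/colP => i; rewrite [LHS]mxE mulKmx // [RHS]mxE; apply/eqP.
by rewrite floor_eq mulr0z add0r mulr1z; exact: t01.
Qed.

Lemma redE w : D w -> red w = w.
Proof. by move=> /zfloor_fund w0; rewrite /red w0 lat0 subr0. Qed.

Lemma red_fund x : D (red x).
Proof. by apply/zfloor_fund; rewrite /red -latN zfloorD subrr. Qed.

Lemma redK x : red x + lat (zfloor x) = x.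
Proof. by rewrite /red subrK. Qed.

Lemma measurable_invmx_coord i :
  measurable_fun [set: E] (fun x : V => (invmx M *m x) i 0 : measurableTypeR R).
Proof.
rewrite (_ : (fun _ => _) = fun x : V => \sum_j invmx M i j * x j 0); last first.
  by apply/funext => x; rewrite !mxE.
apply: (@measurable_sum _ E R setT _ _ (fun j (x : V) => invmx M i j * x j 0)).
move=> j; apply: (@measurableT_comp _ _ _ E _ _ ( *%R (invmx M i j))).
  exact: mulrl_measurable.
exact: measurable_coord.
Qed.

Lemma measurable_zfloor z : measurable ([set x : V | zfloor x = z] : set E).
Proof.
rewrite (_ : mkset _ = \bigcap_(i in [set: 'I_d])
  ((fun x : V => (invmx M *m x) i 0 : measurableTypeR R) @^-1`
     `[(z i 0)%:~R, (z i 0 + 1)%:~R[%classic)); last first.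
  apply/seteqP; split => x /=.
    by move=> <- i _ /=; rewrite in_itv /= !mxE -floor_eq.
  move=> H; apply/colP => i; have := H i I; rewrite /= in_itv /= -floor_eq => /eqP.
  by rewrite !mxE.
apply: fin_bigcap_measurable => // i _.
rewrite -[X in measurable X]setTI; apply: measurable_invmx_coord => //.
Qed.

Lemma measurable_fund : measurable D.
Proof.
rewrite (_ : D = [set x : V | zfloor x = 0]); first exact: measurable_zfloor.
by apply/funext => x; apply/propext; split => /zfloor_fund.
Qed.

Lemma measurable_shiftfun t : measurable_fun [set: E] (fun x : V => (t + x : E)).
Proof. by move=> _ A mA; rewrite setTI; exact: measurable_shift. Qed.

Lemma ge0_integral_shift t (A : set E) (f : E -> \bar R) : measurable A ->
  measurable_fun A f -> (forall x, 0 <= f x)%E ->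
  (\int[leb]_(x in A) f x =
   \int[leb]_(x in [set x : V | A (t + x)%R]) f (t + x)%R)%E.
Proof.
move=> mA mf f0.
apply: (@ge0_integral_preserving _ E R leb _ (measurable_shiftfun t)) => //.
by move=> B mB; exact: leb_shift.
Qed.

Lemma esum_lattice (g : V -> \bar R) :
  (\esum_(l in lattice M) g l = \esum_(z in [set: 'cV[int]_d]) g (lat z))%E.
Proof. by rewrite (esum_image setT lat) // => y z _ _; exact: lat_inj. Qed.

(** The lattice is enumerated through the codes of integer vectors, so that a sum over it becomes a
    series of measurable functions; a number that codes no vector contributes 0. *)
Definition lattice_term (f : E -> \bar R) (m : nat) (w : E) : \bar R :=
  if @pickle_inv 'cV[int]_d m is Some z then f (w + lat z)%R else 0%E.

Lemma lattice_term_ge0 f m w : (forall x, 0 <= f x)%E -> (0 <= lattice_term f m w)%E.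
Proof. by move=> f0; rewrite /lattice_term; case: pickle_inv. Qed.

Lemma measurable_lattice_term f m : measurable_fun [set: E] f ->
  measurable_fun D (lattice_term f m).
Proof.
move=> mf; rewrite /lattice_term; case: pickle_inv => [z|]; last exact: measurable_cst.
apply: measurable_funTS.
rewrite (_ : (fun _ => _) = f \o (fun x : V => lat z + x)).
  exact: (measurableT_comp mf (measurable_shiftfun (lat z))).
by apply/funext => x /=; rewrite addrC.
Qed.

Lemma esum_lattice_term (f : E -> \bar R) (w : E) : (forall x, 0 <= f x)%E ->
  (\esum_(l in lattice M) f (w + l)%R = \sum_(m <oo) lattice_term f m w)%E.
Proof.
move=> f0; rewrite nneseries_esumT; last by move=> m; exact: lattice_term_ge0.
rewrite esum_lattice.
pose Q := [set m | isSome (@pickle_inv 'cV[int]_d m)].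
transitivity (\esum_(m in Q) lattice_term f m w)%E; last first.
  rewrite [LHS]esum_mkcond; apply: eq_esum => m _.
  case: ifPn => //; rewrite notin_setE /Q /lattice_term /=.
  by case: pickle_inv.
have bijQ : set_bij [set: 'cV[int]_d] Q choice.pickle.
  split.
  - by move=> z _; rewrite /Q /= pickleK_inv.
  - by move=> y z _ _; move=> /(pcan_inj (@choice.pickleK _)).
  - move=> m; rewrite /Q /=; case Em : pickle_inv => [z|//] _; exists z => //.
    by have := @pickle_invK 'cV[int]_d m; rewrite Em.
rewrite (reindex_esum _ _ _ _ bijQ); apply: eq_esum => z _.
by rewrite /lattice_term pickleK_inv.
Qed.

Lemma measurable_esum_lattice (f : E -> \bar R) :
  measurable_fun [set: E] f -> (forall x, 0 <= f x)%E ->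
  measurable_fun D (fun w => \esum_(l in lattice M) f (w + l)%R)%E.
Proof.
move=> mf f0; under eq_fun do rewrite esum_lattice_term //.
by apply: ge0_emeasurable_sum => // m *;
  [exact: lattice_term_ge0|exact: measurable_lattice_term].
Qed.

(** The cells [lat z + D] partition the space. Each is translated back to [D], and nonnegativity
    allows the sum and the integral to be exchanged. *)
Lemma ge0_integral_periodize (f : E -> \bar R) :
  measurable_fun [set: E] f -> (forall x, 0 <= f x)%E ->
  (\int[leb]_x f x =
   \int[leb]_(w in D) \esum_(l in lattice M) f (w + l)%R)%E.
Proof.
move=> mf f0.
(* The cells listed by code; the cell of a number that codes no vector is empty. *)
pose F m : set E := if @pickle_inv 'cV[int]_d m is Some z
                    then [set x : V | zfloor x = z] else set0.
have mF m : measurable (F m).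
  by rewrite /F; case: pickle_inv => // z; exact: measurable_zfloor.
have UF : \bigcup_m F m = setT.
  apply/seteqP; split => // x _; exists (choice.pickle (zfloor x)) => //.
  by rewrite /F pickleK_inv.
have tF : trivIset setT F.
  apply/trivIsetP => i j _ _ ij; apply/seteqP; split => // x [].
  rewrite /F; case Ei : pickle_inv => [y|//]; case Ej : pickle_inv => [z|//].
  move=> /= xy xz; move/eqP: ij; apply.
  have /= <- := @pickle_invK 'cV[int]_d i; have /= := @pickle_invK 'cV[int]_d j.
  by rewrite Ei Ej /= -xy -xz.
rewrite -UF ge0_integral_bigcup //; last by rewrite UF.
transitivity (\sum_(m <oo) \int[leb]_(w in D) lattice_term f m w)%E.
  apply: eq_eseriesr => m _; rewrite /F /lattice_term.
  case: pickle_inv => [z|]; last by rewrite integral_set0 integral0.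
  have mfz : measurable_fun ([set x : V | zfloor x = z] : set E) f.
    exact: measurable_funTS mf.
  rewrite (ge0_integral_shift (lat z) (measurable_zfloor z) mfz f0).
  rewrite (_ : mkset _ = D).
    by apply: eq_integral => x _; rewrite addrC.
  apply/funext => x; apply/propext => /=; rewrite addrC zfloorD -zfloor_fund.
  by split => [/eqP|->]; rewrite ?add0r // -subr_eq0 addrK => /eqP.
rewrite -integral_nneseries.
- by apply: eq_integral => w _; rewrite esum_lattice_term.
- exact: measurable_fund.
- by move=> m; exact: measurable_lattice_term.
- by move=> m w _; exact: lattice_term_ge0.
Qed.

End periodization.

(** * Complex-valued functions *)

Section square_modulus.
Import complex.
Context (R : realType).
Local Notation C := R[i].
Implicit Types (z w : C).

Lemma sqmodE z : sqmod z = complex.Re z ^+ 2 + complex.Im z ^+ 2.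
Proof.
case: z => a b; rewrite /sqmod /Normc.normc /= sqr_sqrtr //.
by rewrite addr_ge0 // sqr_ge0.
Qed.

Lemma sqmod_ge0 z : 0 <= sqmod z. Proof. exact: sqr_ge0. Qed.

Lemma sqmod0 : sqmod (0 : C) = 0. Proof. by rewrite sqmodE /= expr0n addr0. Qed.

Lemma sqmod1 : sqmod (1 : C) = 1.
Proof. by rewrite sqmodE /= expr0n addr0 expr1n. Qed.

Lemma sqmodM z w : sqmod (z * w) = sqmod z * sqmod w.
Proof. by rewrite /sqmod Normc.normcM exprMn. Qed.

Lemma sqmodN z : sqmod (- z) = sqmod z.
Proof. by rewrite !sqmodE; case: z => a b /=; rewrite !sqrrN. Qed.

Lemma sqmodC (a : R) : sqmod (real_complex R a) = a ^+ 2.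
Proof. by rewrite sqmodE /= expr0n addr0. Qed.

Lemma sqmodD_le z w : sqmod (z + w) <= 2 * (sqmod z + sqmod w).
Proof.
rewrite !sqmodE; case: z w => [a b] [a' b'] /=.
have := sqr_ge0 (a - a'); have := sqr_ge0 (b - b'); rewrite !expr2; lra.
Qed.

(** The crude constant comes from iterating [sqmodD_le]; what matters is that it depends only on the
    number of terms. *)
Lemma sqmod_sum_le (I : Type) (s : seq I) (F : I -> C) :
  sqmod (\sum_(i <- s) F i) <= 2 ^+ size s * \sum_(i <- s) sqmod (F i).
Proof.
elim: s => [|i s IH]; first by rewrite !big_nil sqmod0 mulr0.
rewrite !big_cons /= exprS; apply: le_trans (sqmodD_le _ _) _.
rewrite -mulrA ler_pM2l // mulrDr lerD //.
by rewrite ler_peMl ?sqmod_ge0 // exprn_ege1 // ler1n.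
Qed.

End square_modulus.

Section cmeas.
Import complex.
Context (R : realType) d (T : measurableType d).
Local Notation C := R[i].
Implicit Types (D : set T) (f g : T -> C).

Definition cmeas D f :=
  measurable_fun D (fun x => complex.Re (f x)) /\
  measurable_fun D (fun x => complex.Im (f x)).

Lemma cmeas_cst D c : cmeas D (fun=> c).
Proof. by split; exact: measurable_cst. Qed.

Lemma cmeas_real D (u : T -> R) : measurable_fun D u ->
  cmeas D (fun x => real_complex R (u x)).
Proof. by move=> mu; split => //; exact: measurable_cst. Qed.

Lemma cmeasD D f g : cmeas D f -> cmeas D g -> cmeas D (fun x => f x + g x).
Proof.
move=> [f1 f2] [g1 g2]; split.
  rewrite (_ : (fun _ => _) = (fun x => complex.Re (f x)) \+ (fun x => complex.Re (g x))).
    exact: measurable_funD.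
  by apply/funext => x /=; case: (f x) (g x) => [? ?] [].
rewrite (_ : (fun _ => _) = (fun x => complex.Im (f x)) \+ (fun x => complex.Im (g x))).
  exact: measurable_funD.
by apply/funext => x /=; case: (f x) (g x) => [? ?] [].
Qed.

Lemma cmeasM D f g : cmeas D f -> cmeas D g -> cmeas D (fun x => f x * g x).
Proof.
move=> [f1 f2] [g1 g2]; split.
  rewrite (_ : (fun _ => _) =
    ((fun x => complex.Re (f x)) \* (fun x => complex.Re (g x))) \-
    ((fun x => complex.Im (f x)) \* (fun x => complex.Im (g x)))).
    by apply: measurable_funB; exact: measurable_funM.
  by apply/funext => x /=; case: (f x) (g x) => [? ?] [].
rewrite (_ : (fun _ => _) =
    ((fun x => complex.Re (f x)) \* (fun x => complex.Im (g x))) \+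
    ((fun x => complex.Im (f x)) \* (fun x => complex.Re (g x)))).
  by apply: measurable_funD; exact: measurable_funM.
by apply/funext => x /=; case: (f x) (g x) => [? ?] [].
Qed.

Lemma cmeasN D f : cmeas D f -> cmeas D (fun x => - f x).
Proof.
move=> mf; rewrite (_ : (fun _ => _) = (fun x => -1 * f x)).
  exact/cmeasM/mf/cmeas_cst.
by apply/funext => x; rewrite mulN1r.
Qed.

Lemma cmeasB D f g : cmeas D f -> cmeas D g -> cmeas D (fun x => f x - g x).
Proof. by move=> mf mg; apply: cmeasD => //; exact: cmeasN. Qed.

Lemma cmeas_sum D (I : Type) (s : seq I) (F : I -> T -> C) :
  (forall i, cmeas D (F i)) -> cmeas D (fun x => \sum_(i <- s) F i x).
Proof.
move=> mF; elim: s => [|i s IH].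
  by under eq_fun do rewrite big_nil; exact: cmeas_cst.
by under eq_fun do rewrite big_cons; exact: cmeasD.
Qed.

Lemma cmeasS D D' f : measurable D' -> D `<=` D' -> cmeas D' f -> cmeas D f.
Proof. by move=> mD DD' [f1 f2]; split; exact: measurable_funS DD' _. Qed.

Lemma cmeasT D f : cmeas setT f -> cmeas D f.
Proof. exact: cmeasS. Qed.

Lemma measurable_sqmod D f : cmeas D f -> measurable_fun D (fun x => sqmod (f x)).
Proof.
move=> [f1 f2]; under eq_fun do rewrite sqmodE.
by apply: measurable_funD; exact: measurable_funX.
Qed.

Lemma measurable_esqmod D f : cmeas D f ->
  measurable_fun D (fun x => (sqmod (f x))%:E).
Proof. by move=> mf; apply/measurable_EFinP; exact: measurable_sqmod. Qed.

End cmeas.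

(** * The character [t -> e^(2 pi i t)] *)

Section expi2pi.
Import complex.
Context (R : realType).
Local Notation e := (@expi2pi R).

Lemma expi2piD s t : e (s + t) = e s * e t.
Proof. by rewrite /expi2pi mulrDr cosD sinD; congr Complex; rewrite addrC. Qed.

Lemma expi2pi0 : e 0 = 1.
Proof. by rewrite /expi2pi mulr0 cos0 sin0. Qed.

Lemma expi2piN_mul t : e (- t) * e t = 1.
Proof. by rewrite -expi2piD addNr expi2pi0. Qed.

Lemma expi2pi_half : e 2^-1 = -1.
Proof.
rewrite /expi2pi (_ : 2 * pi * 2^-1 = pi) ?cospi ?sinpi; last by field.
by apply/eqP; rewrite eq_complex /= oppr0 !eqxx.
Qed.

Lemma expi2pi1 : e 1 = 1.
Proof.
by rewrite (splitr 1) mul1r expi2piD expi2pi_half mulrNN mulr1.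
Qed.

Lemma expi2piMn t n : e (t *+ n) = e t ^+ n.
Proof.
by elim: n => [|n IH]; rewrite ?mulr0n ?expi2pi0 // mulrS expi2piD IH exprS.
Qed.

Lemma expi2pi_int (p : int) : e p%:~R = 1.
Proof.
case: p => n; first by rewrite -pmulrn expi2piMn expi2pi1 expr1n.
rewrite NegzE mulrNz; have := expi2piN_mul (n.+1%:R).
by rewrite expi2piMn expi2pi1 expr1n mulr1.
Qed.

Lemma sqmod_expi2pi t : sqmod (e t) = 1.
Proof. by rewrite sqmodE /= cos2Dsin2. Qed.

(** By the double angle formula [cos (2 pi t) = 1] would force [sin (pi t) = 0], whereas [pi t] lies
    strictly between 0 and [pi]. *)
Lemma expi2pi_neq1 t : 0 < t < 1 -> e t != 1.
Proof.
move=> /andP[t0 t1]; rewrite /expi2pi; apply/negP; rewrite eq_complex /= => /andP[/eqP + _].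
have s0 : 0 < sin (pi * t).
  by apply: sin_gt0_pi; rewrite mulr_gt0 ?pi_gt0 //= gtr_pMr ?pi_gt0.
rewrite (_ : 2 * pi * t = (pi * t) *+ 2); last by rewrite mulr2n; ring.
rewrite cos_mulr2n => c1; have := cos2Dsin2 (pi * t).
have : 0 < sin (pi * t) ^+ 2 by rewrite exprn_gt0.
move: c1; rewrite mulr2n; lra.
Qed.

End expi2pi.

(** * Square-integrable functions *)

Section bounded_measurable.
Context (R : realType) d (T : measurableType d).
Import HBNNSimple.

(** A functional monotone class principle. Indicators give simple functions; these increase to any
    nonnegative bounded function while staying below it, hence below [K]; positive and negative
    parts give the rest. *)
Lemma bounded_measurable_ind (P : (T -> R) -> Prop) :
  (forall A, measurable A -> P \1_A) ->
  (forall f g, P f -> P g -> P (fun x => f x + g x)) ->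
  (forall a f, P f -> P (fun x => a * f x)) ->
  (forall (f_ : nat -> T -> R) f K, (forall m, P (f_ m)) ->
    (forall m x, `|f_ m x| <= K) ->
    (forall x, f_ m x @[m --> \oo] --> f x) -> P f) ->
  forall (f : T -> R) K, measurable_fun setT f -> (forall x, `|f x| <= K) -> P f.
Proof.
move=> Pind PD PZ Plim.
have Psimple (f : {nnsfun T >-> R}) : P f.
  rewrite (_ : (f : T -> R) = fun x => \sum_(y <- fset_set (range f))
      (y * \1_(f @^-1` [set y]) x)); last first.
    by apply/funext => x; rewrite fimfunE fsbig_finite.
  move: (enum_fset _) => s; elim: s => [|y s IH].
    rewrite (_ : (fun _ => _) = fun x => 0 * \1_set0 x).
      exact/PZ/Pind/measurable0.
    by apply/funext => x; rewrite big_nil mul0r.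
  rewrite (_ : (fun _ => _) = fun x => y * \1_(f @^-1` [set y]) x +
      \sum_(y <- s) (y * \1_(f @^-1` [set y]) x)).
    by apply: PD => //; exact/PZ/Pind.
  by apply/funext => x; rewrite big_cons.
have Ppos (f : T -> R) K : measurable_fun setT f -> (forall x, 0 <= f x <= K) -> P f.
  move=> mf f0K.
  have mf' : measurable_fun setT (EFin \o f) by exact/measurable_EFinP.
  have f0 x : setT x -> (0 <= (EFin \o f) x)%E.
    by move=> _; rewrite lee_fin; have /andP[] := f0K x.
  apply: (Plim (fun n => nnsfun_approx measurableT mf' n) f K) => //.
    move=> n x; rewrite ger0_norm //.
    have := le_approx n f0 (I : setT x); rewrite -(nnsfun_approxE measurableT mf').
    by rewrite lee_fin => /le_trans; apply; have /andP[] := f0K x.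
  move=> x; have := cvg_approx f0 (I : setT x) (ltry (f x)).
  rewrite /=; under eq_fun do rewrite -(nnsfun_approxE measurableT mf').
  exact.
move=> f K mf fK.
rewrite (_ : f = fun x => f^\+ x + (-1) * f^\- x); last first.
  by apply/funext => x; rewrite mulN1r -[in LHS](funrposBneg f).
have pos_le x : 0 <= f^\+ x <= K.
  rewrite /funrpos le_max lexx orbT /= ge_max (le_trans (ler_norm _) (fK x)) /=.
  exact: le_trans (fK x).
have neg_le x : 0 <= f^\- x <= K.
  rewrite /funrneg le_max lexx orbT /= ge_max.
  rewrite (le_trans (ler_norm _)) ?normrN //=.
  exact: le_trans (fK x).
by apply: PD; [|apply: PZ]; [apply: Ppos pos_le; exact: measurable_funrpos|
  apply: Ppos neg_le; exact: measurable_funrneg].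
Qed.

End bounded_measurable.

Section nrm2.
Import complex.
Context (R : realType) d (T : measurableType d).
Context (mu : {measure set T -> \bar R}) (O : set T) (mO : measurable O).
Local Notation C := R[i].
Local Notation rc := (real_complex R).
Implicit Types (f g w : T -> C).

(** The analogue of [sqnormL2] over an arbitrary measure space; below it is used both on [Omega] and
    on the fundamental domain. *)
Definition nrm2 f : \bar R := (\int[mu]_(x in O) (sqmod (f x))%:E)%E.

Definition L2 f := cmeas O f /\ (nrm2 f < +oo)%E.

Lemma nrm2_ge0 f : (0 <= nrm2 f)%E.
Proof. by apply: integral_ge0 => x _; rewrite lee_fin sqmod_ge0. Qed.

Lemma nrm2_eq f g : (forall x, O x -> f x = g x) -> nrm2 f = nrm2 g.
Proof. by move=> fg; apply: eq_integral => x /set_mem Ox; rewrite fg. Qed.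

(** Takes the place of the triangle inequality for squared norms. Approximations below are therefore
    made within [eps / 4], since [2 (eps/4 + eps/4) = eps]. *)
Lemma nrm2D_le f g : cmeas O f -> cmeas O g ->
  (nrm2 (fun x => f x + g x)%R <= 2%:E * (nrm2 f + nrm2 g))%E.
Proof.
move=> mf mg; rewrite /nrm2.
have m1 := measurable_esqmod mf; have m2 := measurable_esqmod mg.
have p h x : O x -> (0 <= (sqmod (h x : C))%:E)%E by rewrite lee_fin sqmod_ge0.
rewrite -ge0_integralD //; [|exact: p|exact: p].
rewrite -ge0_integralZl_EFin //; first last.
- exact: emeasurable_funD.
- by move=> x Ox; rewrite adde_ge0 // p.
apply: ge0_le_integral => //.
- exact: p.
- by apply: measurable_esqmod; exact: cmeasD.
- by apply: measurable_funeM; exact: emeasurable_funD.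
- by move=> x _; rewrite -EFinD -EFinM lee_fin sqmodD_le.
Qed.

Lemma nrm2_mul_le w f K : cmeas O w -> cmeas O f -> 0 <= K ->
  (forall x, O x -> sqmod (w x) <= K) ->
  (nrm2 (fun x => w x * f x)%R <= K%:E * nrm2 f)%E.
Proof.
move=> mw mf K0 wK; rewrite /nrm2 -ge0_integralZl_EFin //; first last.
- exact: measurable_esqmod.
- by move=> x _; rewrite lee_fin sqmod_ge0.
apply: ge0_le_integral => //.
- by move=> x _; rewrite lee_fin sqmod_ge0.
- by apply: measurable_esqmod; exact: cmeasM.
- by apply: measurable_funeM; exact: measurable_esqmod.
- by move=> x Ox; rewrite -EFinM lee_fin sqmodM ler_wpM2r ?sqmod_ge0 // wK.
Qed.

Lemma nrm2Z c f : cmeas O f ->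
  nrm2 (fun x => c * f x) = ((sqmod c)%:E * nrm2 f)%E.
Proof.
move=> mf; rewrite /nrm2 -ge0_integralZl_EFin //; first last.
- exact: sqmod_ge0.
- exact: measurable_esqmod.
- by move=> x _; rewrite lee_fin sqmod_ge0.
by apply: eq_integral => x _; rewrite sqmodM EFinM.
Qed.

Lemma L2D f g : L2 f -> L2 g -> L2 (fun x => f x + g x).
Proof.
move=> [mf f2] [mg g2]; split; first exact: cmeasD.
apply: le_lt_trans (nrm2D_le mf mg) _.
by rewrite lte_mul_pinfty // lte_add_pinfty.
Qed.

Lemma L2M w f K : cmeas O w -> (forall x, O x -> sqmod (w x) <= K) -> L2 f ->
  L2 (fun x => w x * f x).
Proof.
move=> mw wK [mf f2]; split; first exact: cmeasM.
apply: (@le_lt_trans _ _ (`|K|%:E * nrm2 f)%E).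
  by apply: nrm2_mul_le => // x Ox; apply: le_trans (wK x Ox) (ler_norm _).
by rewrite lte_mul_pinfty // lee_fin.
Qed.

Lemma L2Z c f : L2 f -> L2 (fun x => c * f x).
Proof. by apply: (L2M (cmeas_cst _ _)) => x _; exact: lexx. Qed.

Lemma L2_sum (I : Type) (s : seq I) (F : I -> T -> C) :
  (forall i, L2 (F i)) -> L2 (fun x => \sum_(i <- s) F i x).
Proof.
move=> F2; elim: s => [|i s IH].
  split; first by under eq_fun do rewrite big_nil; exact: cmeas_cst.
  rewrite /nrm2; under eq_integral do rewrite big_nil sqmod0.
  by rewrite integral0.
by under eq_fun do rewrite big_cons; exact: L2D.
Qed.

(** Dominated convergence: [|w - w_m|^2 |f|^2] tends to 0 pointwise and stays below
    [(2K)^2 |f|^2]. *)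
Lemma nrm2_dominated (w_ : nat -> T -> R) (w : T -> R) K f : L2 f ->
  (forall m, measurable_fun O (w_ m)) ->
  (forall m x, `|w_ m x| <= K) -> (forall x, w_ m x @[m --> \oo] --> w x) ->
  forall eps : R, 0 < eps ->
    exists m, (nrm2 (fun x => rc (w x) * f x - rc (w_ m x) * f x)%R < eps%:E)%E.
Proof.
move=> [mf f2] mw_ w_K w_w eps eps0.
have mw : measurable_fun O w by apply: (measurable_fun_cvg mw_) => x _; exact: w_w.
have wK x : `|w x| <= K.
  rewrite -(cvg_lim _ (cvg_norm (w_w x))) //.
  apply: limr_le; first by apply: cvgP (cvg_norm (w_w x)).
  by apply: nearW => m; exact: w_K.
pose h m x : \bar R := (sqmod (rc (w x) * f x - rc (w_ m x) * f x))%:E.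
have hE m x : h m x = ((w x - w_ m x) ^+ 2 * sqmod (f x))%:E.
  by rewrite /h -mulrBl -rmorphB sqmodM sqmodC.
have [] := @dominated_convergence _ _ _ mu O mO h (cst 0%E)
    (fun x => ((2 * K) ^+ 2 * sqmod (f x))%:E).
- move=> m; apply: measurable_esqmod; apply: cmeasB; apply: cmeasM => //;
    exact: cmeas_real.
- exact: measurable_cst.
- apply: aeW => x Ox; under eq_fun do rewrite hE.
  apply: cvg_EFin; first exact: nearW.
  rewrite /comp /=.
  rewrite [X in _ --> X](_ : _ = (w x - w x) ^+ 2 * sqmod (f x)); last first.
    by rewrite subrr expr0n mul0r.
  apply: cvgM; last exact: cvg_cst.
  rewrite expr2; under eq_fun do rewrite expr2.
  by apply: cvgM; apply: cvgB => //; exact: cvg_cst.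
- apply/integrableP; split.
    apply/measurable_EFinP; apply: measurable_funM => //.
    exact: measurable_sqmod.
  rewrite (eq_integral (fun x => ((2 * K) ^+ 2)%:E * (sqmod (f x))%:E)%E); last first.
    by move=> x _; rewrite gee0_abs // lee_fin mulr_ge0 ?sqr_ge0 ?sqmod_ge0.
  rewrite ge0_integralZl_EFin ?sqr_ge0 //; first last.
  + exact: measurable_esqmod.
  + by move=> x _; rewrite lee_fin sqmod_ge0.
  by rewrite lte_mul_pinfty // lee_fin sqr_ge0.
- apply: aeW => x m Ox; rewrite hE gee0_abs ?lee_fin; last by rewrite mulr_ge0 ?sqr_ge0 ?sqmod_ge0.
  rewrite ler_wpM2r ?sqmod_ge0 // -[leLHS]real_normK ?num_real //.
  rewrite lerXn2r ?nnegrE //.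
    by rewrite mulr_ge0 // (le_trans _ (wK x)).
  by rewrite (le_trans (ler_normB _ _)) // mulrDl mul1r lerD.
move=> _ _; rewrite integral0 => /fine_cvgP[hfin].
move=> /cvgrPdist_lt /(_ eps eps0) hlt.
near \oo => m; exists m.
have : `|0 - fine (\int[mu]_(x in O) h m x)%E| < eps by near: m.
rewrite sub0r normrN => /(le_lt_trans (ler_norm _)).
rewrite -lte_fin fineK //.
by near: m.
Unshelve. all: by end_near. Qed.

End nrm2.

(** * Closed linear spans and their multipliers *)

Section closed_span.
Import complex.
Context (R : realType) d (T : measurableType d).
Context (mu : {measure set T -> \bar R}) (O : set T) (mO : measurable O).
Local Notation C := R[i].
Local Notation rc := (real_complex R).
Context (I : Type) (e : I -> T -> C).
Hypothesis eL2 : forall i, L2 mu O (e i).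
Implicit Types (f g w : T -> C) (u : T -> R).
Local Notation N2 := (nrm2 mu O).
Local Notation L2 := (L2 mu O).

(** An index may occur several times in the list, so that adding two combinations is mere
    concatenation; [lin_span_fcomb] collects the repetitions at the end. *)
Definition lin_span : set (T -> C) :=
  [set f | exists s : seq (C * I), f = fun x => \sum_(p <- s) p.1 * e p.2 x].

Definition closed_span : set (T -> C) :=
  [set f | L2 f /\ forall eps : R, 0 < eps ->
    exists2 g, lin_span g & (N2 (fun x => f x - g x)%R < eps%:E)%E].

Lemma lin_span_L2 f : lin_span f -> L2 f.
Proof. by move=> [s ->]; apply: L2_sum => // p; exact: L2Z. Qed.

Lemma lin_spanD f g : lin_span f -> lin_span g -> lin_span (fun x => f x + g x).
Proof.
move=> [s ->] [t ->]; exists (s ++ t).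
by apply/funext => x; rewrite big_cat.
Qed.

Lemma lin_spanZ c f : lin_span f -> lin_span (fun x => c * f x).
Proof.
move=> [s ->]; exists [seq (c * p.1, p.2) | p <- s].
by apply/funext => x; rewrite big_map mulr_sumr; under [RHS]eq_bigr do rewrite -mulrA.
Qed.

Lemma closed_span_L2 f : closed_span f -> L2 f. Proof. by case. Qed.

Lemma lin_closed_span f : lin_span f -> closed_span f.
Proof.
move=> sf; split; first exact: lin_span_L2.
move=> eps eps0; exists f => //; rewrite /nrm2.
by under eq_integral do rewrite subrr sqmod0; rewrite integral0 lte_fin.
Qed.

Lemma closed_spanD f g : closed_span f -> closed_span g ->
  closed_span (fun x => f x + g x).
Proof.
move=> [f2 af] [g2 ag]; split; first exact: L2D.
move=> eps eps0; have e4 : 0 < eps / 4 by rewrite divr_gt0.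
have [f' sf f'lt] := af _ e4; have [g' sg g'lt] := ag _ e4.
exists (fun x => f' x + g' x); first exact: lin_spanD.
have mf : cmeas O (fun x => f x - f' x).
  by apply: cmeasB; [case: f2|case: (lin_span_L2 sf)].
have mg : cmeas O (fun x => g x - g' x).
  by apply: cmeasB; [case: g2|case: (lin_span_L2 sg)].
under [X in N2 X]eq_fun do rewrite opprD addrACA.
apply: le_lt_trans (nrm2D_le mu mO mf mg) _.
rewrite (_ : eps = 2 * (eps / 4 + eps / 4)); last by field.
by rewrite EFinM lte_pmul2l ?lte_fin // EFinD lteD.
Qed.

Lemma closed_spanZ c f : closed_span f -> closed_span (fun x => c * f x).
Proof.
move=> [f2 af]; split; first exact: L2Z.
(* The added 1 keeps the divisor positive when [c = 0]. *)
move=> eps eps0; have c0 : 0 < sqmod c + 1 by rewrite ltr_wpDl ?sqmod_ge0.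
have [g sg glt] := af _ (divr_gt0 eps0 c0).
exists (fun x => c * g x); first exact: lin_spanZ.
under [X in N2 X]eq_fun do rewrite -mulrBr.
rewrite nrm2Z //; last first.
  by apply: cmeasB; [case: f2|case: (lin_span_L2 sg)].
apply: (@le_lt_trans _ _ ((sqmod c + 1)%:E * N2 (fun x => f x - g x)%R)%E).
  by rewrite lee_wpmul2r ?nrm2_ge0 // lee_fin lerDl.
by rewrite -(divfK (lt0r_neq0 c0) eps) mulrC EFinM lte_pmul2l.
Qed.

Lemma closed_span_sum (J : Type) (s : seq J) (F : J -> T -> C) :
  (forall j, closed_span (F j)) -> closed_span (fun x => \sum_(j <- s) F j x).
Proof.
move=> sF; elim: s => [|j s IH].
  by apply: lin_closed_span; exists [::]; apply/funext => x; rewrite !big_nil.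
by under eq_fun do rewrite big_cons; exact: closed_spanD.
Qed.

Lemma closed_span_closed f : L2 f ->
  (forall eps : R, 0 < eps ->
    exists2 g, closed_span g & (N2 (fun x => f x - g x)%R < eps%:E)%E) ->
  closed_span f.
Proof.
move=> f2 af; split => // eps eps0; have e4 : 0 < eps / 4 by rewrite divr_gt0.
have [g [g2 ag] fg] := af _ e4; have [h sh gh] := ag _ e4; exists h => //.
have mf : cmeas O (fun x => f x - g x) by apply: cmeasB; [case: f2|case: g2].
have mg : cmeas O (fun x => g x - h x).
  by apply: cmeasB; [case: g2|case: (lin_span_L2 sh)].
rewrite (_ : (fun _ => _) = fun x => (f x - g x) + (g x - h x)); last first.
  by apply/funext => x; rewrite addrA subrK.
apply: le_lt_trans (nrm2D_le mu mO mf mg) _.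
rewrite (_ : eps = 2 * (eps / 4 + eps / 4)); last by field.
by rewrite EFinM lte_pmul2l ?lte_fin // EFinD lteD.
Qed.

(** Elements of [closed_span] are functions, not classes; this lets them be changed on a null set,
    since the difference has norm 0. *)
Lemma closed_span_ae f g : closed_span g -> cmeas O f ->
  {ae mu, forall x, O x -> f x = g x} -> closed_span f.
Proof.
move=> sg mf fg; have [[mg g2] _] := sg.
have mfg : cmeas O (fun x => f x - g x) by exact: cmeasB.
have fg0 : N2 (fun x => f x - g x) = 0%E.
  rewrite /nrm2 -[RHS](integral0 mu O).
  apply: (ge0_ae_eq_integral mO (measurable_esqmod mfg) (measurable_cst _)) => //.
    by move=> x _; rewrite lee_fin sqmod_ge0.
  by move: fg; apply: filterS => x fgx Ox; rewrite fgx // subrr sqmod0.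
apply: closed_span_closed => [|eps eps0]; last by exists g; rewrite // fg0 lte_fin.
rewrite (_ : f = fun x => (f x - g x) + g x); last first.
  by apply/funext => x; rewrite subrK.
by apply: L2D => //; split; [exact: mfg|rewrite fg0 ltry].
Qed.

Lemma closed_span_dominated (w_ : nat -> T -> R) (w : T -> R) K f : L2 f ->
  (forall m, measurable_fun O (w_ m)) ->
  (forall m x, `|w_ m x| <= K) -> (forall x, w_ m x @[m --> \oo] --> w x) ->
  (forall m, closed_span (fun x => rc (w_ m x) * f x)) ->
  closed_span (fun x => rc (w x) * f x).
Proof.
move=> f2 mw_ w_K w_w sw_; apply: closed_span_closed; last first.
  move=> eps eps0.
  have [m lt] := nrm2_dominated mO f2 mw_ w_K w_w eps0.
  by exists (fun x => rc (w_ m x) * f x).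
apply: (@L2M _ _ _ _ _ mO _ _ (K ^+ 2)) => //.
  by apply: cmeas_real; apply: (measurable_fun_cvg mw_) => x _; exact: w_w.
move=> x _; rewrite sqmodC -[leLHS]real_normK ?num_real //.
have wK : `|w x| <= K.
  rewrite -(cvg_lim _ (cvg_norm (w_w x))) //.
  apply: limr_le; first by apply: cvgP (cvg_norm (w_w x)).
  by apply: nearW => m; exact: w_K.
by rewrite lerXn2r ?nnegrE // (le_trans _ wK).
Qed.

Definition multiplier w := [/\ cmeas setT w, exists K, forall x, sqmod (w x) <= K &
  forall f, closed_span f -> closed_span (fun x => w x * f x)].

(** Multiplication by a bounded function is continuous in [L2], so preserving the algebraic span is
    enough to preserve its closure. *)
Lemma multiplier_span w K : cmeas setT w -> (forall x, sqmod (w x) <= K) ->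
  (forall f, lin_span f -> lin_span (fun x => w x * f x)) -> multiplier w.
Proof.
move=> mw wK sw; have mwO : cmeas O w by exact: cmeasT.
have K1 : 0 < `|K| + 1 by rewrite ltr_wpDl.
have wK' x : O x -> sqmod (w x) <= `|K| + 1.
  by move=> _; rewrite (le_trans (wK x)) // (le_trans (ler_norm _)) // lerDl.
split => //; first by exists K.
move=> f [f2 af]; split; first exact: (L2M mO mwO wK').
move=> eps eps0; have [g sg glt] := af _ (divr_gt0 eps0 K1).
exists (fun x => w x * g x); first exact: sw.
under [X in N2 X]eq_fun do rewrite -mulrBr.
apply: le_lt_trans (nrm2_mul_le mu mO mwO _ (ltW K1) wK') _.
  by apply: cmeasB; [case: f2|case: (lin_span_L2 sg)].
by rewrite -(divfK (lt0r_neq0 K1) eps) mulrC EFinM lte_pmul2l.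
Qed.

Lemma multiplier_cst c : multiplier (fun=> c).
Proof.
split; [exact: cmeas_cst|by exists (sqmod c)|].
by move=> f; exact: closed_spanZ.
Qed.

Lemma multiplierD v w : multiplier v -> multiplier w ->
  multiplier (fun x => v x + w x).
Proof.
move=> [mv [K vK] sv] [mw [K' wK] sw]; split; first exact: cmeasD.
  exists (2 * (K + K')) => x; apply: le_trans (sqmodD_le _ _) _.
  by rewrite ler_wpM2l // lerD.
by move=> f sf; under eq_fun do rewrite mulrDl; apply: closed_spanD; auto.
Qed.

Lemma multiplierM v w : multiplier v -> multiplier w ->
  multiplier (fun x => v x * w x).
Proof.
move=> [mv [K vK] sv] [mw [K' wK] sw]; split; first exact: cmeasM.
  exists (K * K') => x; rewrite sqmodM.
  by apply: ler_pM => //; exact: sqmod_ge0.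
by move=> f sf; under eq_fun do rewrite -mulrA; auto.
Qed.

Definition rmultiplier u := multiplier (fun x => rc (u x)).

Lemma rmultiplier_cst a : rmultiplier (fun=> a).
Proof. exact: multiplier_cst. Qed.

Lemma rmultiplierD u v : rmultiplier u -> rmultiplier v ->
  rmultiplier (fun x => u x + v x).
Proof.
move=> mu' mv; rewrite /rmultiplier; under eq_fun do rewrite rmorphD.
exact: (multiplierD mu' mv).
Qed.

Lemma rmultiplierM u v : rmultiplier u -> rmultiplier v ->
  rmultiplier (fun x => u x * v x).
Proof.
move=> mu' mv; rewrite /rmultiplier; under eq_fun do rewrite rmorphM.
exact: (multiplierM mu' mv).
Qed.

Lemma rmultiplierX u n : rmultiplier u -> rmultiplier (fun x => u x ^+ n).
Proof.
move=> mu'; elim: n => [|n IH].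
  by under eq_fun do rewrite expr0; exact: rmultiplier_cst.
by under eq_fun do rewrite exprS; exact: rmultiplierM.
Qed.

Lemma rmultiplier_measurable u : rmultiplier u -> measurable_fun setT u.
Proof. by case=> -[]. Qed.

Lemma rmultiplier_bounded u : rmultiplier u -> exists K, forall x, `|u x| <= K.
Proof.
(* The bound follows from [2 |u| <= 1 + u^2]. *)
move=> [_ [K uK] _]; exists (K + 1) => x.
have := uK x; rewrite sqmodC -real_normK ?num_real //.
have := sqr_ge0 (`|u x| - 1); rewrite !expr2; have := normr_ge0 (u x); nra.
Qed.

(** The closure property that drives the density proof: by dominated convergence, multiplying by the
    limit is an [L2] limit of products that already lie in the closed span. *)
Lemma rmultiplier_lim (u_ : nat -> T -> R) u K :
  (forall m, rmultiplier (u_ m)) -> (forall m x, `|u_ m x| <= K) ->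
  (forall x, u_ m x @[m --> \oo] --> u x) -> rmultiplier u.
Proof.
move=> mu_ u_K u_u.
have mu' : measurable_fun setT u.
  apply: (@measurable_fun_cvg _ _ _ setT u_); last by move=> x _; exact: u_u.
  by move=> m; exact: rmultiplier_measurable.
split; first exact: cmeas_real.
  exists (K ^+ 2) => x; rewrite sqmodC -[leLHS]real_normK ?num_real //.
  have uK : `|u x| <= K.
    rewrite -(cvg_lim _ (cvg_norm (u_u x))) //.
    apply: limr_le; first by apply: cvgP (cvg_norm (u_u x)).
    by apply: nearW => m; exact: u_K.
  by rewrite lerXn2r ?nnegrE // (le_trans _ uK).
move=> f sf; apply: (closed_span_dominated (closed_span_L2 sf) _ u_K u_u).
  by move=> m; apply: measurable_funTS; exact: rmultiplier_measurable.
by move=> m; have [_ _] := mu_ m; exact.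
Qed.

(** The partial sums of the exponential series are polynomials in [u], all bounded by [expR K] when
    [|u| <= K]. *)
Lemma rmultiplier_expR u : rmultiplier u -> rmultiplier (fun x => expR (u x)).
Proof.
move=> mu'; have [K uK] := rmultiplier_bounded mu'.
apply: (@rmultiplier_lim (fun m x => series (exp_coeff (u x)) m) _ (expR K)).
- move=> m; elim: m => [|m IH].
    by under eq_fun do rewrite /series /= big_geq //; exact: rmultiplier_cst.
  under eq_fun do rewrite /series /= big_nat_recr //=.
  apply: (rmultiplierD IH); rewrite /exp_coeff.
  exact: (rmultiplierM (rmultiplierX m mu') (rmultiplier_cst _)).
- move=> m x; apply: (@le_trans _ _ (series (exp_coeff `|u x|) m)).
    rewrite -normed_series_exp_coeff /series /=.
    exact: ler_norm_sum.
  apply: (@le_trans _ _ (expR `|u x|)); last by rewrite ler_expR.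
  apply: nondecreasing_cvgn_le; last exact: is_cvg_series_exp_coeff.
  apply: nondecreasing_series => n _ _; exact: exp_coeff_ge0.
- by move=> x; exact: is_cvg_series_exp_coeff.
Qed.

(* [expR (- expR (- m (u - c)))] tends to [1], [expR (- 1)] or [0] according to
   the sign of [u - c]; powers of the limit then kill the middle value. *)
Lemma rmultiplier_gt u c : rmultiplier u -> rmultiplier \1_[set x | c < u x].
Proof.
move=> mu'.
pose z x := expR (c - u x).
pose g x : R := if c < u x then 1 else if u x == c then expR (-1) else 0.
have mz : rmultiplier z.
  rewrite /z; apply: rmultiplier_expR.
  rewrite (_ : (fun _ => _) = fun x => c + (-1) * u x).
    exact: (rmultiplierD (rmultiplier_cst c) (rmultiplierM (rmultiplier_cst (-1)) mu')).
  by apply/funext => x; rewrite mulN1r.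
have mg : rmultiplier g.
  apply: (@rmultiplier_lim (fun m x => expR (-1 * z x ^+ m)) _ 1).
  - move=> m; apply: rmultiplier_expR; apply: rmultiplierM.
      exact: (rmultiplier_cst (-1)).
    exact: (rmultiplierX m mz).
  - move=> m x; rewrite ger0_norm ?expR_ge0 // -[leRHS]expR0 ler_expR mulN1r.
    by rewrite oppr_le0 exprn_ge0 // expR_ge0.
  - move=> x; rewrite /g /z; case: ltgtP => [ltcu|ltuc|<-].
    + rewrite [X in _ --> X](_ : 1 = expR (-1 * 0)); last by rewrite mulr0 expR0.
      apply: continuous_cvg; first exact: continuous_expR.
      apply: cvgMr; apply: cvg_expr.
      by rewrite ger0_norm ?expR_ge0 // expR_lt1 subr_lt0.
    + set y := expR (u x - c).
      have y1 : y ^+ m @[m --> \oo] --> 0.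
        by apply: cvg_expr; rewrite ger0_norm ?expR_ge0 // expR_lt1 subr_lt0.
      apply: (squeeze_cvgr _ (cvg_cst 0) y1).
      apply: nearW => m; rewrite expR_ge0 /= mulN1r expRN.
      rewrite (_ : y = (expR (c - u x))^-1); last by rewrite -expRN opprB.
      rewrite exprVn lef_pV2 ?posrE ?expR_gt0 ?exprn_gt0 ?expR_gt0 //.
      by apply: le_trans (expR_ge1Dx _); rewrite lerDr.
    + rewrite subrr expR0; under eq_fun do rewrite expr1n mulr1.
      exact: cvg_cst.
apply: (@rmultiplier_lim (fun m x => g x ^+ m) _ 1).
- by move=> m; exact: rmultiplierX.
- move=> m x; rewrite normrX exprn_ile1 //.
  have e1 : `|expR (-1 : R)| <= 1.
    by rewrite ger0_norm ?expR_ge0 // ltW // expR_lt1 ltrN10.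
  by rewrite /g; case: ltgtP => _; rewrite ?normr1 ?normr0.
- move=> x; rewrite indicE /g; case: ltgtP => cu.
  + rewrite mem_set //; under eq_fun do rewrite expr1n; exact: cvg_cst.
  + rewrite memNset /=; last by move/lt_trans => /(_ _ cu); rewrite ltxx.
    by apply: cvg_expr; rewrite normr0.
  + rewrite memNset /=; last by rewrite cu ltxx.
    by apply: cvg_expr; rewrite ger0_norm ?expR_ge0 // expR_lt1 ltrN10.
Qed.

End closed_span.

(** * Completeness of the space of square-integrable functions *)

Section L2_complete.
Import complex.
Context (R : realType) d (T : measurableType d).
Context (mu : {measure set T -> \bar R}) (O : set T) (mO : measurable O).
Local Notation C := R[i].
Local Notation rc := (real_complex R).

(** With [y = 2^m |r_(m+1) - r_m|], the bound [y^2 <= G] gives [y <= 1 + G], so the increments are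
    dominated by the geometric series of terms [(1 + G) 2^-m]. *)
Lemma cvgn_fast_increments (r : nat -> R) (G : R) :
  (forall m, 4 ^+ m * (r m.+1 - r m) ^+ 2 <= G) -> cvgn r.
Proof.
move=> rG; have r_series m : r m = r 0%N + series (fun i => r i.+1 - r i) m.
  rewrite /series /=; elim: m => [|m IH]; first by rewrite big_geq // addr0.
  by rewrite big_nat_recr //= addrA -IH addrC subrK.
rewrite (_ : r = fun m => r 0%N + series (fun i => r i.+1 - r i) m); last first.
  by apply/funext => m; rewrite -r_series.
apply: is_cvgD; first exact: is_cvg_cst.
apply: normed_cvg.
apply: (@series_le_cvg _ _ (geometric (1 + G) 2^-1)) => [n|n|n|].
- exact: normr_ge0.
- rewrite /geometric /= mulr_ge0 // ?exprn_ge0 //.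
  have := rG 0%N; rewrite expr0 mul1r; have := sqr_ge0 (r 1%N - r 0%N); lra.
- rewrite /geometric /= exprVn ler_pdivlMr ?exprn_gt0 //.
  have := rG n; rewrite (_ : 4 = 2 ^+ 2); last by rewrite expr2; lra.
  rewrite exprAC -exprMn -real_normK ?num_real // normrM.
  rewrite (ger0_norm (exprn_ge0 _ _)) // mulrC.
  by move=> yG; have := sqr_ge0 (`|r n.+1 - r n| * 2 ^+ n - 1); nra.
- apply: is_cvg_geometric_series; rewrite ger0_norm ?invr_ge0 // invf_lt1 //.
  by rewrite ltr1n.
Qed.

(** A form of the Riesz-Fischer theorem for sequences with a prescribed geometric rate. The rate
    [16^-m] leaves room for the weight [4^m], which yields pointwise convergence almost everywhere;
    Fatou's lemma then keeps the same rate for the limit. *)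
Lemma L2_complete (S_ : nat -> T -> C) : (forall m, L2 mu O (S_ m)) ->
  (forall m p, (m <= p)%N ->
    (nrm2 mu O (fun x => S_ p x - S_ m x)%R <= (16^-1 ^+ m)%:E)%E) ->
  exists S, L2 mu O S /\
    forall m, (nrm2 mu O (fun x => S x - S_ m x)%R <= (16^-1 ^+ m)%:E)%E.
Proof.
move=> L2S dS.
have mS m : cmeas O (S_ m) by case: (L2S m).
pose u m x := S_ m.+1 x - S_ m x.
have mu' m : cmeas O (u m) by exact: cmeasB.
(* The integral of [t m] is at most [4^m 16^-m = 4^-m], so the sum [g] has integral at most [4/3]
   and is finite almost everywhere. *)
pose t m x : \bar R := (4 ^+ m * sqmod (u m x))%:E.
have t0 m x : (0 <= t m x)%E by rewrite lee_fin; apply: mulr_ge0; [exact: exprn_ge0|exact: sqmod_ge0].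
have mt m : measurable_fun O (t m).
  apply/measurable_EFinP; apply: measurable_funM; first exact: measurable_cst.
  exact: measurable_sqmod.
pose g x := (\sum_(m <oo) t m x)%E.
have mg : measurable_fun O g.
  by apply: ge0_emeasurable_sum => // m x _ _; exact: t0.
have ig : (\int[mu]_(x in O) g x < +oo)%E.
  rewrite integral_nneseries //.
  apply: (@le_lt_trans _ _ (4 / 3)%:E); last exact: ltry.
  apply: lime_le; first by apply: is_cvg_nneseries => m _ _; exact: integral_ge0.
  apply: nearW => n.
  apply: (@le_trans _ _ (\sum_(0 <= m < n) (4^-1 ^+ m)%:E)%E).
    apply: lee_sum => m _.
    rewrite /t; under eq_integral do rewrite EFinM.
    rewrite ge0_integralZl_EFin ?exprn_ge0 //; first last.
    - exact: measurable_esqmod.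
    - by move=> x _; rewrite lee_fin sqmod_ge0.
    apply: (@le_trans _ _ ((4 ^+ m)%:E * (16^-1 ^+ m)%:E)%E).
      by rewrite lee_wpmul2l ?lee_fin ?exprn_ge0 // dS.
    rewrite -EFinM lee_fin -exprMn (_ : 4 * 16^-1 = 4^-1) //.
    by field.
  rewrite sumEFin lee_fin.
  have -> : \sum_(0 <= m < n) (4^-1 : R) ^+ m = 4 / 3 * (1 - 4^-1 ^+ n).
    elim: n => [|n IH]; first by rewrite big_geq // expr0 subrr mulr0.
    by rewrite big_nat_recr //= IH exprS; field.
  by rewrite ler_piMr // lerBlDr lerDl exprn_ge0.
have g_fin : {ae mu, forall x, O x -> g x \is a fin_num}.
  apply: integrable_ae => //; apply/integrableP; split => //.
  rewrite (eq_integral g) // => x _; rewrite gee0_abs //.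
  by apply: nneseries_ge0 => m _ _.
have [N [mN N0 gN]] := g_fin.
pose A := O `\` N.
have mA : measurable A by exact: measurableD.
have tG x m : A x -> 4 ^+ m * sqmod (u m x) <= fine (g x).
  move=> [Ox Nx]; have gx : g x \is a fin_num.
    by apply: contrapT => h; apply: Nx; apply: gN => /(_ Ox).
  rewrite -lee_fin fineK //.
  apply: (@le_trans _ _ (\sum_(0 <= i < m.+1) t i x)%E).
    by rewrite big_nat_recr //= leeDr // sume_ge0.
  by apply: nneseries_lim_ge => i _ _; exact: t0.
have le_Re (z : C) : complex.Re z ^+ 2 <= sqmod z by rewrite sqmodE lerDl sqr_ge0.
have le_Im (z : C) : complex.Im z ^+ 2 <= sqmod z by rewrite sqmodE lerDr sqr_ge0.
have ReB (z w : C) : complex.Re (z - w) = complex.Re z - complex.Re w.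
  by case: z w => [? ?] [].
have ImB (z w : C) : complex.Im (z - w) = complex.Im z - complex.Im w.
  by case: z w => [? ?] [].
have cRe x : A x -> cvgn (fun m => complex.Re (S_ m x)).
  move=> Ax; apply: (@cvgn_fast_increments _ (fine (g x))) => m.
  apply: le_trans (tG x m Ax); rewrite ler_wpM2l ?exprn_ge0 // -ReB.
  exact: le_Re.
have cIm x : A x -> cvgn (fun m => complex.Im (S_ m x)).
  move=> Ax; apply: (@cvgn_fast_increments _ (fine (g x))) => m.
  apply: le_trans (tG x m Ax); rewrite ler_wpM2l ?exprn_ge0 // -ImB.
  exact: le_Im.
(* The cut-off by [A] changes the sequence only on a null subset of [O], and makes it converge at
   every point, so that the limit is measurable. *)
pose S' m x := rc (\1_A x) * S_ m x.
pose S x := rc (\1_A x) * Complex (limn (fun m => complex.Re (S_ m x)))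
                                  (limn (fun m => complex.Im (S_ m x))).
have mS' m : cmeas O (S' m).
  by apply: cmeasM => //; apply: cmeas_real; exact: measurable_indic.
have S'Re x : complex.Re (S' m x) @[m --> \oo] --> complex.Re (S x).
  rewrite /S' /S indicE; case: (boolP (x \in A)) => [/set_mem Ax|_].
    by rewrite rmorph1 mul1r; under eq_fun do rewrite mul1r; exact: cRe.
  by rewrite rmorph0 mul0r; under eq_fun do rewrite mul0r; exact: cvg_cst.
have S'Im x : complex.Im (S' m x) @[m --> \oo] --> complex.Im (S x).
  rewrite /S' /S indicE; case: (boolP (x \in A)) => [/set_mem Ax|_].
    by rewrite rmorph1 mul1r; under eq_fun do rewrite mul1r; exact: cIm.
  by rewrite rmorph0 mul0r; under eq_fun do rewrite mul0r; exact: cvg_cst.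
have mS0 : cmeas O S.
  split.
    apply: (@measurable_fun_cvg _ _ _ O (fun m x => complex.Re (S' m x))) => //.
    by move=> m; case: (mS' m).
  apply: (@measurable_fun_cvg _ _ _ O (fun m x => complex.Im (S' m x))) => //.
  by move=> m; case: (mS' m).
have dist m : (nrm2 mu O (fun x => S x - S_ m x)%R <= (16^-1 ^+ m)%:E)%E.
  have -> : nrm2 mu O (fun x => S x - S_ m x) = nrm2 mu O (fun x => S x - S' m x).
    apply: ge0_ae_eq_integral => //.
    - by apply: measurable_esqmod; exact: cmeasB.
    - by apply: measurable_esqmod; exact: cmeasB.
    - by move=> x _; rewrite lee_fin sqmod_ge0.
    - by move=> x _; rewrite lee_fin sqmod_ge0.
    exists N; split => // x /= /not_implyP[Ox Sx]; apply: contrapT => Nx.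
    by apply: Sx; rewrite /S' indicE mem_set // rmorph1 mul1r.
  pose f p x := (sqmod (S' p x - S' m x))%:E.
  (* The integrand converges, so the lower limit in Fatou's lemma is its limit. *)
  have fE x : limn_einf (f^~ x) = (sqmod (S x - S' m x))%:E.
    apply: (cvg_limn_einf_sup _).1; apply: cvg_EFin; first exact: nearW.
    rewrite /f /comp /=; under eq_fun do rewrite sqmodE ReB ImB !expr2.
    rewrite sqmodE ReB ImB !expr2.
    by apply: cvgD; apply: cvgM; apply: cvgB => //; exact: cvg_cst.
  rewrite /nrm2; under eq_integral do rewrite -fE.
  apply: le_trans (fatou mu mO _ _) _.
  - by move=> p; apply: measurable_esqmod; exact: cmeasB.
  - by move=> p x _; rewrite lee_fin sqmod_ge0.
  rewrite limn_einf_lim; apply: lime_le; first exact: is_cvg_einfs.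
  apply: nearW => n; rewrite /einfs /=.
  (* The infimum over indices at least [n] is tested at one that is also at least [m], where the
     Cauchy bound applies. *)
  apply: (@le_trans _ _ (\int[mu]_(x in O) f (maxn n m) x)%E).
    by apply: ereal_inf_lbound; exists (maxn n m) => //=; exact: leq_maxl.
  apply: le_trans (dS m (maxn n m) (leq_maxr _ _)).
  apply: ge0_le_integral => //.
  - by move=> x _; rewrite lee_fin sqmod_ge0.
  - by apply: measurable_esqmod; exact: cmeasB.
  - by apply: measurable_esqmod; exact: cmeasB.
  move=> x _; rewrite lee_fin /S' -mulrBr sqmodM sqmodC.
  by rewrite ler_piMl ?sqmod_ge0 // exprn_ile1 // indicE lern1 leq_b1.
exists S; split=> //.
rewrite (_ : S = fun x => (S x - S_ 0%N x) + S_ 0%N x); last first.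
  by apply/funext => x; rewrite subrK.
apply: L2D => //; split; first exact: cmeasB.
by apply: le_lt_trans (dist 0%N) _; rewrite ltry.
Qed.

End L2_complete.

(** * From frame bounds to l2 sums *)

Section frame_sums.
Import complex.
Context (R : realType) d (T : measurableType d).
Context (mu : {measure set T -> \bar R}) (O : set T) (mO : measurable O).
Local Notation C := R[i].
Context (I : choiceType) (e : I -> T -> C).
Hypothesis eL2 : forall i, L2 mu O (e i).
Local Notation N2 := (nrm2 mu O).

Definition fcomb (c : I -> C) (F : {fset I}) : T -> C :=
  fun x => \sum_(g <- F) c g * e g x.

Lemma big_fset_subD (V : nmodType) (F0 F : {fset I}) (f : I -> V) :
  (F0 `<=` F)%fset ->
  \sum_(g <- F) f g = \sum_(g <- F0) f g + \sum_(g <- (F `\` F0)%fset) f g.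
Proof.
move=> /fsubsetP sF; rewrite (big_fsetID _ (mem F0)) /=; congr (_ + _).
  by apply: eq_fbigl => x; rewrite !inE /=; apply/andP/idP => [[]//|xF]; rewrite sF.
by apply: eq_fbigl => x; rewrite !inE /= andbC.
Qed.

Lemma fcomb_subD c (F0 F : {fset I}) x : (F0 `<=` F)%fset ->
  fcomb c F x = fcomb c F0 x + fcomb c (F `\` F0)%fset x.
Proof. exact: big_fset_subD. Qed.

Lemma fcomb_L2 c F : L2 mu O (fcomb c F).
Proof. by apply: L2_sum => // i; exact: L2Z. Qed.

Lemma esum_ge_fset (a : I -> R) (F : {fset I}) :
  ((\sum_(g <- F) a g)%:E <= \esum_(g in [set: I]) (a g)%:E)%E.
Proof.
apply: esum_ge; exists [set` F]; first by split.
by rewrite fsbig_finite // set_fsetK sumEFin.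
Qed.

Lemma esum_le_fset (a : I -> R) (B : \bar R) :
  (forall F : {fset I}, ((\sum_(g <- F) a g)%:E <= B)%E) ->
  (\esum_(g in [set: I]) (a g)%:E <= B)%E.
Proof.
move=> aB; apply: ge_ereal_sup => _ [X [finX _] <-].
by rewrite fsbig_finite // sumEFin.
Qed.

(** A finite set that captures the total up to [eps] leaves less than [eps] for any finite set
    disjoint from it. *)
Lemma l2_tail c (eps : R) : (sqnorml2 c < +oo)%E -> 0 < eps ->
  exists F0 : {fset I}, forall F : {fset I}, [disjoint F & F0]%fset ->
    \sum_(g <- F) sqmod (c g) < eps.
Proof.
move=> cfin eps0.
have c0 : (0 <= sqnorml2 c)%E.
  by apply: esum_ge0 => g _; rewrite lee_fin sqmod_ge0.
have cfn : sqnorml2 c \is a fin_num by rewrite ge0_fin_numE.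
have [_ [X [finX _] <-] ltX] := ub_ereal_sup_adherent eps0 cfn.
move: ltX; rewrite fsbig_finite // sumEFin -/(sqnorml2 c); set F0 := fset_set X => ltX.
exists F0 => F /fdisjointP FF0.
have := esum_ge_fset (fun g => sqmod (c g)) (F0 `|` F)%fset.
rewrite (@big_fset_subD _ F0) ?fsubsetUl //.
have -> : ((F0 `|` F) `\` F0 = F)%fset.
  apply/fsetP => x; rewrite !inE; apply/andP/idP => [[xF0]|xF].
    by rewrite (negbTE xF0).
  by split; [exact: FF0|rewrite xF orbT].
rewrite -/(sqnorml2 c) -(fineK cfn) lee_fin.
by move: ltX; rewrite -[X in (X - _ < _)%E]/(sqnorml2 c) -(fineK cfn) -EFinB lte_fin; lra.
Qed.

Context (A0 K : R) (A00 : 0 < A0) (K0 : 0 < K).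
Hypothesis frame : forall c (F : {fset I}),
  ((A0 * \sum_(g <- F) sqmod (c g))%:E <= N2 (fcomb c F))%E /\
  (N2 (fcomb c F) <= (K * \sum_(g <- F) sqmod (c g))%:E)%E.

(** The upper bound makes the partial sums along a suitable chain of finite sets Cauchy, which
    provides [S]. Both frame bounds then pass to the limit, each losing a factor 2 through
    [nrm2D_le]. *)
Lemma frame_sum c : (sqnorml2 c < +oo)%E -> exists S, [/\ L2 mu O S,
  forall eps : R, 0 < eps -> exists F0 : {fset I}, forall F : {fset I},
    (F0 `<=` F)%fset -> (N2 (fun x => (S x - fcomb c F x)%R) < eps%:E)%E,
  ((A0 / 2)%:E * sqnorml2 c <= N2 S)%E & (N2 S <= (2 * K)%:E * sqnorml2 c)%E].
Proof.
move=> cfin.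
have mcomb F : cmeas O (fcomb c F) by case: (fcomb_L2 c F).
(* Dividing by [K] compensates the upper frame bound and leaves the rate required by
   [L2_complete]. *)
have tail m : exists F0 : {fset I}, forall F : {fset I}, [disjoint F & F0]%fset ->
    \sum_(g <- F) sqmod (c g) < 16^-1 ^+ m / K.
  by apply: l2_tail => //; rewrite divr_gt0 // exprn_gt0.
have [F_ F_tail] := choice tail.
(* Unions make the chosen sets increasing in [m]. *)
pose G_ m : {fset I} := (\bigcup_(i <- iota 0 m.+1) F_ i)%fset.
have G_le m p : (m <= p)%N -> (G_ m `<=` G_ p)%fset.
  move=> mp; apply/bigfcupsP => i; rewrite mem_iota => im _.
  apply: (@bigfcup_sup _ _ _ i) => //.
  by rewrite mem_iota; case/andP: im => _ /=; rewrite !add0n => /leq_trans; apply.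
have FG m : (F_ m `<=` G_ m)%fset.
  by apply: (@bigfcup_sup _ _ _ m) => //; rewrite mem_iota leq0n add0n ltnSn.
have tailG m (F : {fset I}) : [disjoint F & G_ m]%fset ->
    (N2 (fcomb c F) <= (16^-1 ^+ m)%:E)%E.
  move=> FGm; apply: le_trans (frame c F).2 _; rewrite lee_fin.
  rewrite mulrC -ler_pdivlMr //; apply/ltW/F_tail.
  by apply: fdisjointWr FGm; exact: FG.
have disjD (F F0 : {fset I}) : [disjoint (F `\` F0)%fset & F0]%fset.
  by apply/fdisjointP => x; rewrite inE => /andP[].
have [S [L2S dS]] : exists S, L2 mu O S /\
    forall m, (N2 (fun x => S x - fcomb c (G_ m) x)%R <= (16^-1 ^+ m)%:E)%E.
  apply: L2_complete => // [m|m p mp]; first exact: fcomb_L2.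
  rewrite (@nrm2_eq _ _ _ _ _ _ (fcomb c (G_ p `\` G_ m)%fset)); last first.
    by move=> x _; rewrite (fcomb_subD _ _ (G_le _ _ mp)) addrC addKr.
  exact: tailG.
have mS : cmeas O S by case: L2S.
have sumS eps : 0 < eps -> exists F0 : {fset I}, forall F : {fset I},
    (F0 `<=` F)%fset -> (N2 (fun x => (S x - fcomb c F x)%R) < eps%:E)%E.
  move=> eps0; have : 16^-1 ^+ m @[m --> \oo] --> (0 : R).
    by apply: cvg_expr; rewrite ger0_norm ?invr_ge0 // invf_lt1 // ltr1n.
  move=> /cvgrPdist_lt /(_ (eps / 4)) [|m _ mlt]; first by rewrite divr_gt0.
  have {}mlt : 16^-1 ^+ m < eps / 4.
    have := mlt m (leqnn m); rewrite /= sub0r normrN => /(le_lt_trans _); apply.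
    exact: ler_norm.
  exists (G_ m) => F GF.
  rewrite (@nrm2_eq _ _ _ _ _ _ (fun x => (S x - fcomb c (G_ m) x) +
      -1 * fcomb c (F `\` G_ m)%fset x)); last first.
    by move=> x _; rewrite (fcomb_subD _ _ GF) opprD addrA mulN1r.
  apply: le_lt_trans (nrm2D_le mu mO _ _) _.
  - exact: cmeasB.
  - by apply: cmeasM => //; exact: cmeas_cst.
  rewrite (nrm2Z mu mO) // sqmodN sqmod1 mul1e.
  apply: (@le_lt_trans _ _ (2%:E * (16^-1 ^+ m + 16^-1 ^+ m)%:E)%E).
    by rewrite lee_wpmul2l // EFinD leeD // tailG.
  by rewrite -EFinM lte_fin; move: mlt; lra.
have c0 : (0 <= sqnorml2 c)%E.
  by apply: esum_ge0 => g _; rewrite lee_fin sqmod_ge0.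
exists S; split => //.
- rewrite -(@lee_pmul2l _ 2%:E) // muleA -EFinM mulrC divfK //.
  rewrite -(@lee_pmul2l _ (A0^-1)%:E) ?lte_fin ?invr_gt0 // muleA -EFinM.
  rewrite mulVf ?gt_eqF // mul1e.
  apply: esum_le_fset => F; apply/lee_addgt0Pr => eps eps0.
  (* This error is doubled by [nrm2D_le] and divided by [A0], which turns it into [eps]. *)
  have [F0 F0S] := sumS (eps * A0 / 2) (divr_gt0 (mulr_gt0 eps0 A00) (ltr0Sn R 1)).
  have := F0S (F0 `|` F)%fset (fsubsetUl _ _); set F' := (F0 `|` F)%fset => dist.
  apply: (@le_trans _ _ ((A0^-1)%:E * N2 (fcomb c F'))%E).
    apply: (@le_trans _ _ (A0^-1 * (A0 * \sum_(g <- F') sqmod (c g)))%:E).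
      rewrite mulKf ?gt_eqF // lee_fin (@big_fset_subD _ F F') ?fsubsetUr //.
      by rewrite lerDl sumr_ge0 // => g _; exact: sqmod_ge0.
    by rewrite EFinM lee_wpmul2l ?lee_fin ?invr_ge0 ?(ltW A00) //; exact: (frame c F').1.
  rewrite (_ : eps%:E = (A0^-1)%:E * (2 * (eps * A0 / 2))%:E)%E; last first.
    by rewrite -EFinM; congr EFin; field; rewrite gt_eqF.
  have d0 : 0 < eps * A0 / 2 by rewrite divr_gt0 // mulr_gt0.
  rewrite -ge0_muleDr ?mule_ge0 ?nrm2_ge0 //; last by rewrite lee_fin mulr_ge0 ?(ltW d0).
  rewrite lee_wpmul2l ?lee_fin ?invr_ge0 ?(ltW A00) //.
  rewrite (@nrm2_eq _ _ _ _ _ _ (fun x => S x + -1 * (S x - fcomb c F' x))); last first.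
    by move=> x _; rewrite mulN1r opprB addrC subrK.
  apply: le_trans (nrm2D_le mu mO mS _) _.
    by apply: cmeasM; [exact: cmeas_cst|exact: cmeasB].
  rewrite (nrm2Z mu mO); last exact: cmeasB.
  rewrite sqmodN sqmod1 mul1e ge0_muleDr ?nrm2_ge0 // leeD2l // EFinM.
  by rewrite lee_wpmul2l // ltW.
- apply/lee_addgt0Pr => eps eps0.
  have [F0 F0S] := sumS (eps / 2) (divr_gt0 eps0 (ltr0Sn R 1)).
  have dist := F0S F0 (fsubset_refl _).
  rewrite (@nrm2_eq _ _ _ _ _ _ (fun x => fcomb c F0 x + (S x - fcomb c F0 x))); last first.
    by move=> x _; rewrite addrC subrK.
  apply: le_trans (nrm2D_le mu mO (mcomb F0) _) _; first exact: cmeasB.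
  rewrite ge0_muleDr ?nrm2_ge0 // leeD //; last first.
    rewrite (_ : eps = 2 * (eps / 2)); last by field.
    by rewrite EFinM lee_wpmul2l // ltW.
  rewrite EFinM -muleA lee_wpmul2l //; apply: le_trans (frame c F0).2 _.
  by rewrite EFinM lee_wpmul2l ?lee_fin ?(ltW K0) // esum_ge_fset.
Qed.

End frame_sums.

(** * Interpolation and orthogonality *)

Section lagrange.
Import complex.
Context (R : realType) (n k : nat).
Local Notation C := R[i].
Variable z : 'I_n -> C.
Hypothesis z_inj : injective z.
Implicit Types (S : {set 'I_n}) (s t : 'I_n).

Definition lagrange S s : {poly C} :=
  (\prod_(t <- enum (S :\ s)) (z s - z t))^-1 *:
  \prod_(t <- enum (S :\ s)) ('X - (z t)%:P).

Lemma size_lagrange S s : s \in S -> (size (lagrange S s) <= #|S|)%N.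
Proof.
move=> sS; apply: leq_trans (size_scale_leq _ _) _.
by rewrite size_prod_XsubC -cardE (cardsD1 s S) sS.
Qed.

Lemma horner_lagrange S s t : t \in S -> (lagrange S s).[z t] = (t == s)%:R.
Proof.
move=> tS; rewrite hornerZ horner_prod.
rewrite [X in _ * X](eq_bigr (fun u => z t - z u)) => [|u _]; last first.
  by rewrite hornerXsubC.
have [->|ts] := eqVneq t s.
  rewrite mulVf // prodf_seq_neq0; apply/allP => u.
  rewrite mem_enum !inE => /andP[us _] /=.
  by rewrite subr_eq0 (inj_eq z_inj) eq_sym.
rewrite [X in _ * X](_ : _ = 0) ?mulr0 //; apply/eqP.
rewrite prodf_seq_eq0; apply/hasP; exists t; last by rewrite /= subrr.
by rewrite mem_enum !inE ts.
Qed.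

Lemma interpolation S s : #|S| = k -> s \in S ->
  exists c : 'I_k -> C, forall t, t \in S ->
    \sum_(j < k) c j * z t ^+ j = (t == s)%:R.
Proof.
move=> Sk sS; exists (fun j => (lagrange S s)`_j) => t tS.
by rewrite -(horner_lagrange s tS) (@horner_coef_wide _ k) // -Sk size_lagrange.
Qed.

(** A polynomial of degree less than [k] is recovered from its values at [k] nodes by Lagrange's
    formula, which bounds its coefficients. *)
Lemma interpolation_bound : exists2 B : R, 0 < B & forall S, #|S| = k ->
  forall c : 'I_k -> C, \sum_j sqmod (c j) <=
    B * \sum_(s in S) sqmod (\sum_(j < k) c j * z s ^+ j).
Proof.
pose b S s := \sum_(j < k) sqmod (lagrange S s)`_j.
have b0 S s : 0 <= b S s by apply: sumr_ge0 => j _; exact: sqmod_ge0.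
(* Summing over all subsets makes the constant independent of [S]; the factor [2 ^+ k] comes from
   [sqmod_sum_le] over the [k] nodes, and the 1 ensures positivity. *)
pose B := 1 + 2 ^+ k * \sum_S \sum_s b S s.
have s0 : 0 <= \sum_S \sum_s b S s by apply: sumr_ge0 => S _; exact: sumr_ge0.
exists B; first by rewrite ltr_wpDr // mulr_ge0 // exprn_ge0.
move=> S Sk c; pose Q : {poly C} := \poly_(j < k) (if insub j is Some i then c i else 0).
have Qc (j : 'I_k) : Q`_j = c j.
  by rewrite coef_poly ltn_ord; case: insubP => [i _ /val_inj ->|]; rewrite ?ltn_ord.
have Qz s : Q.[z s] = \sum_(j < k) c j * z s ^+ j.
  by rewrite (@horner_coef_wide _ k) ?size_poly //; under eq_bigr do rewrite Qc.
pose P := \sum_(s <- enum S) Q.[z s] *: lagrange S s.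
(* The difference has degree less than [k] and vanishes at [k] distinct nodes. *)
have QP : Q = P.
  apply/eqP; rewrite -subr_eq0; apply/eqP.
  apply: (@roots_geq_poly_eq0 _ _ [seq z s | s <- enum S]).
  - apply/allP => _ /mapP[t + ->]; rewrite mem_enum => tS.
    rewrite /root hornerD hornerN horner_sum (bigD1_seq t) ?mem_enum ?enum_uniq //=.
    rewrite hornerZ horner_lagrange // eqxx mulr1 big1_seq ?addr0 ?subrr // => s.
    by move=> /andP[st sS]; rewrite hornerZ horner_lagrange // eq_sym (negbTE st) mulr0.
  - by rewrite map_inj_uniq ?enum_uniq.
  - rewrite size_map -cardE Sk; apply: leq_trans (size_polyD _ _) _.
    rewrite size_polyN geq_max size_poly; apply: leq_trans (size_sum _ _ _) _.
    apply/bigmax_leqP_seq => s; rewrite mem_enum => sS _.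
    by apply: leq_trans (size_scale_leq _ _) _; rewrite -Sk size_lagrange.
have cE j : c j = \sum_(s <- enum S) Q.[z s] * (lagrange S s)`_j.
  by rewrite -Qc QP coef_sum; under eq_bigr do rewrite coefZ; rewrite -QP.
apply: (@le_trans _ _ (\sum_(j < k) 2 ^+ k *
    \sum_(s <- enum S) sqmod Q.[z s] * sqmod (lagrange S s)`_j)).
  apply: ler_sum => j _; rewrite cE.
  apply: le_trans (sqmod_sum_le _ _) _; rewrite -cardE Sk.
  by under eq_bigr do rewrite sqmodM.
rewrite -mulr_sumr exchange_big /= big_enum /= mulr_sumr mulr_sumr.
apply: ler_sum => s sS; rewrite -mulr_sumr -/(b S s) -Qz mulrCA mulrC.
rewrite ler_wpM2r ?sqmod_ge0 // /B ler_wpDl // ler_wpM2l ?exprn_ge0 //.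
rewrite (bigD1 S) //= (bigD1 s) //= -addrA lerDl addr_ge0 ?sumr_ge0 // => S' _.
exact: sumr_ge0.
Qed.

End lagrange.

(** * Pythagoras' identity for orthogonal systems of unimodular functions *)

Section orthogonal.
Import complex.
Context (R : realType) d (T : measurableType d).
Context (mu : {measure set T -> \bar R}) (D : set T) (mD : measurable D).
Hypothesis D_fin : (mu D < +oo)%E.
Local Notation C := R[i].
Context (I : choiceType) (e : I -> T -> C).
Hypothesis me : forall g, cmeas D (e g).
Hypothesis e1 : forall g x, sqmod (e g x) = 1.

(** Letting the factor [u] range over all complex numbers captures the real and imaginary parts of
    the inner product, while only real integrals are written. *)
Definition orthogonal_on (g g' : I) := forall u : C,
  (\int[mu]_(x in D) (complex.Re (u * e g x * conjc (e g' x)))%:E = 0)%E.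

Lemma sqmodD_Re (z w : C) :
  sqmod (z + w) = sqmod z + sqmod w + 2 * complex.Re (z * conjc w).
Proof. by rewrite !sqmodE; case: z w => [a b] [a' b'] /=; ring. Qed.

Lemma ReD (z w : C) : complex.Re (z + w) = complex.Re z + complex.Re w.
Proof. by case: z w => [? ?] []. Qed.

Lemma sqmod_conjc (z : C) : sqmod (conjc z) = sqmod z.
Proof. by rewrite !sqmodE; case: z => a b /=; rewrite sqrrN. Qed.

Lemma cmeas_conjc (f : T -> C) : cmeas D f -> cmeas D (fun x => conjc (f x)).
Proof.
move=> [f1 f2]; split.
  by rewrite (_ : (fun _ => _) = fun x => complex.Re (f x)) //;
    apply/funext => x; case: (f x).
rewrite (_ : (fun _ => _) = \- (fun x => complex.Im (f x))).
  exact: measurable_funN.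
by apply/funext => x /=; case: (f x).
Qed.

(** Induction on the support: expanding [|z + w|^2] leaves a cross term whose integral vanishes, and
    each unimodular term contributes [mu D] times its squared coefficient. *)
Lemma orthogonal_nrm2 (c : I -> C) (F : {fset I}) :
  (forall g g', g \in F -> g' \in F -> g != g' -> orthogonal_on g g') ->
  nrm2 mu D (fcomb e c F) = (mu D * (\sum_(g <- F) sqmod (c g))%:E)%E.
Proof.
have bnd_int (f : T -> C) K : cmeas D f -> (forall x, sqmod (f x) <= K) ->
    mu.-integrable D (fun x => (complex.Re (f x))%:E).
  move=> [mf _] fK; apply: measurable_bounded_integrable => //.
  exists (K + 1); split; first exact: num_real.
  move=> y Ky x _; apply: le_trans (ltW Ky).
  have := fK x; rewrite sqmodE => fK'; have := sqr_ge0 (complex.Im (f x)).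
  have := sqr_ge0 (`|complex.Re (f x)| - 1); rewrite -(real_normK (num_real (complex.Re _))) in fK'.
  nra.
have int_Re u g g' : mu.-integrable D
    (fun x => (complex.Re (u * e g x * conjc (e g' x)))%:E).
  apply: (@bnd_int (fun x => u * e g x * conjc (e g' x)) (sqmod u)).
    by apply: cmeasM; [apply: cmeasM => //; exact: cmeas_cst|exact: cmeas_conjc].
  by move=> x; rewrite !sqmodM sqmod_conjc !e1 !mulr1.
rewrite /nrm2 /fcomb => orth.
have [] : mu.-integrable D (fun x => (sqmod (\sum_(g <- F) c g * e g x))%:E) /\
   (\int[mu]_(x in D) (sqmod (\sum_(g <- F) c g * e g x))%:E =
    mu D * (\sum_(g <- F) sqmod (c g))%:E)%E => //.
have := fset_uniq F; have : {subset enum_fset F <= F} by [].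
elim: (enum_fset F) => [_ _|g s IH sF /andP[gs us]].
  split.
    by under eq_fun do rewrite big_nil sqmod0; exact: integrable0.
  by under eq_integral do rewrite big_nil sqmod0; rewrite integral0 big_nil mule0.
have [|ints Is] := IH _ us.
  by move=> x xs; apply: sF; rewrite inE xs orbT.
have cross x : complex.Re ((\sum_(h <- s) c h * e h x) * conjc (c g * e g x)) =
    \sum_(h <- s) complex.Re (c h * conjc (c g) * e h x * conjc (e g x)).
  rewrite mulr_suml (big_morph (@complex.Re R) (ReD) (erefl : complex.Re 0 = 0)).
  by apply: eq_bigr => h _; congr complex.Re; rewrite rmorphM /=; ring.
(* The cross term is a finite sum of pairings of [e g] with other members of the system, each
   integrating to 0. *)
have crossI : mu.-integrable D (fun x => (complex.Re
    ((\sum_(h <- s) c h * e h x) * conjc (c g * e g x)))%:E) /\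
  (\int[mu]_(x in D) (complex.Re
    ((\sum_(h <- s) c h * e h x) * conjc (c g * e g x)))%:E = 0)%E.
  under eq_fun do rewrite cross.
  have gF : g \in F by apply: sF; rewrite inE eqxx.
  have {}sF : {subset s <= F} by move=> x xs; apply: sF; rewrite inE xs orbT.
  clear cross IH ints Is us; elim: s sF gs => [_ _|h s IH sF].
    split.
      by under eq_fun do rewrite big_nil; exact: integrable0.
    by under eq_integral do rewrite big_nil; rewrite integral0.
  rewrite inE negb_or => /andP[gh gs].
  have [||i0 I0] := IH => //.
    by move=> x xs; apply: sF; rewrite inE xs orbT.
  split.
    under eq_fun do rewrite big_cons EFinD.
    exact: integrableD.
  under eq_integral do rewrite big_cons EFinD.
  rewrite integralD_EFin //; last exact: int_Re.
  rewrite [X in (X + _)%E](_ : _ = 0%E); first by rewrite [X in (_ + X)%E]I0 adde0.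
  by apply: orth => //; [apply: sF; rewrite inE eqxx|rewrite eq_sym].
have [ci cI] := crossI.
have expand x : (sqmod (\sum_(h <- g :: s) c h * e h x))%:E =
   ((sqmod (\sum_(h <- s) c h * e h x))%:E + (sqmod (c g))%:E +
     2%:E * (complex.Re ((\sum_(h <- s) c h * e h x) * conjc (c g * e g x)))%:E)%E.
  by rewrite big_cons addrC sqmodD_Re sqmodM e1 mulr1.
have cst_int : mu.-integrable D (fun=> (sqmod (c g))%:E).
  apply: (@bnd_int (fun=> real_complex R (sqmod (c g))) (sqmod (c g) ^+ 2)).
    exact: cmeas_cst.
  by move=> _; rewrite sqmodC.
split.
  under eq_fun do rewrite expand.
  by apply: integrableD => //; [exact: integrableD|exact: integrableZl].
under eq_integral do rewrite expand.
rewrite integralD //; [|exact: integrableD|exact: integrableZl].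
rewrite integralD // integralZl // cI mule0 adde0 Is integral_cst //.
rewrite big_cons EFinD [in RHS]ge0_muleDr ?lee_fin ?sqmod_ge0 ?sumr_ge0 //.
  by rewrite addeC muleC.
by move=> h _; exact: sqmod_ge0.
Qed.

End orthogonal.

(** * Exponentials on the fundamental domain *)

Section exponentials_on_domain.
Import complex.
Context (R : realType) (d : nat).
Local Notation C := R[i].
Local Notation V := 'cV[R]_d.
Local Notation E := (euclid R d).
Local Notation e := (@expi2pi R).
Implicit Types x y a h l t : V.

Lemma dotDl x y a : dot (x + y) a = dot x a + dot y a.
Proof. by rewrite /dot -big_split; apply: eq_bigr => i _; rewrite mxE mulrDl. Qed.

Lemma dotC x y : dot x y = dot y x.
Proof. by apply: eq_bigr => i _; rewrite mulrC. Qed.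

Lemma dotDr x y a : dot a (x + y) = dot a x + dot a y.
Proof. by rewrite dotC dotDl !(dotC _ a). Qed.

Lemma dotZl (c : R) x y : dot (c *: x) y = c * dot x y.
Proof. by rewrite /dot mulr_sumr; apply: eq_bigr => i _; rewrite mxE mulrA. Qed.

Lemma dotZr (c : R) x y : dot x (c *: y) = c * dot x y.
Proof. by rewrite dotC dotZl dotC. Qed.

Lemma dotNl x y : dot (- x) y = - dot x y.
Proof. by rewrite -scaleN1r dotZl mulN1r. Qed.

Lemma dotNr x y : dot x (- y) = - dot x y.
Proof. by rewrite dotC dotNl dotC. Qed.

Lemma dot_gt0 x : x != 0 -> 0 < dot x x.
Proof.
move=> x0; have xx i : 0 <= x i 0 * x i 0 by rewrite -expr2 sqr_ge0.
rewrite lt_neqAle sumr_ge0 // andbT eq_sym; apply: contra x0.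
rewrite psumr_eq0 // => /allP x0; apply/eqP/colP => i; rewrite mxE.
by have := x0 i (mem_index_enum i); rewrite /= mulf_eq0 orbb => /eqP.
Qed.

Lemma dual_int h (L : set V) l : dual_lattice L h -> L l ->
  exists p : int, dot h l = p%:~R.
Proof. by move=> Hh Ll; apply/intrP/Hh. Qed.

Lemma dual_latticeD (L : set V) h h' : dual_lattice L h -> dual_lattice L h' ->
  dual_lattice L (h + h').
Proof. by move=> Hh Hh' l Ll; rewrite dotDl rpredD ?Hh ?Hh'. Qed.

Lemma dual_latticeN (L : set V) h : dual_lattice L h -> dual_lattice L (- h).
Proof. by move=> Hh l Ll; rewrite dotNl rpredN Hh. Qed.

Lemma expi2pi_dual (L : set V) h x l : dual_lattice L h -> L l ->
  e (dot h (x + l)) = e (dot h x).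
Proof.
move=> Hh Ll; have [p hp] := dual_int Hh Ll.
by rewrite dotDr expi2piD hp expi2pi_int mulr1.
Qed.

Lemma measurable_dot a : measurable_fun [set: E] (fun x : V => dot a x).
Proof.
apply: (@measurable_sum _ E R setT _ _ (fun j (x : V) => a j 0 * x j 0)).
move=> j; apply: (@measurableT_comp _ _ _ E _ _ ( *%R (a j 0))).
  exact: mulrl_measurable.
exact: measurable_coord.
Qed.

Lemma cmeas_expi2pi d' (T : measurableType d') (f : T -> R) :
  measurable_fun setT f -> cmeas setT (fun s => e (f s)).
Proof.
move=> mf; have mf' : measurable_fun setT (fun s => 2 * pi * f s).
  by apply: measurable_funM => //; exact: measurable_cst.
by split; apply: measurableT_comp mf' => //;
  apply: continuous_measurable_fun; [exact: continuous_cos|exact: continuous_sin].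
Qed.

Lemma cmeas_exp_dot a : cmeas (setT : set E) (fun x : E => e (dot a x)).
Proof. exact: (@cmeas_expi2pi _ E _ (measurable_dot a)). Qed.

Variable M : 'M[R]_d.
Hypothesis M_unit : M \in unitmx.
Local Notation D := (fund_domain M : set E).

(** Exactly one lattice translate of [t + x] falls in the fundamental domain. *)
Lemma esum_translate_fund t x (c : R) : 0 <= c ->
  (\esum_(l in lattice M) ((c * \1_D (t + (x + l)))%R%:E) = c%:E)%E.
Proof.
move=> c0; rewrite (esum_lattice M_unit).
rewrite (eq_esum (b := fun z => if z \in [set - zfloor M (t + x)] then c%:E else 0%E)).
  by rewrite -(esum_mkcond [set - zfloor M (t + x)] (fun=> c%:E)) esum_set1.
move=> z _; rewrite indicE addrA.
have -> : (t + x + lat M z \in (fund_domain M : set E)) = (z \in [set - zfloor M (t + x)]).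
  apply/idP/idP => /set_mem H; apply/mem_set.
    move/(zfloor_fund M_unit) : H; rewrite zfloorD //= => /eqP.
    by rewrite addrC addr_eq0 => /eqP.
  by apply/(zfloor_fund M_unit); rewrite zfloorD // H subrr.
by case: (_ \in _); rewrite ?mulr1 ?mulr0.
Qed.

(** The translate [t + D] is again a fundamental domain: an integral over it, folded back onto [D]
    by periodization, meets each class modulo the lattice once. *)
Lemma integral_fund_translate (phi : V -> R) t :
  measurable_fun [set: E] (phi : E -> R) -> (forall x, 0 <= phi x) ->
  (forall x l, lattice M l -> phi (x + l) = phi x) ->
  (\int[leb]_(w in D) (phi (t + w)%R)%:E = \int[leb]_(w in D) (phi w)%:E)%E.
Proof.
move=> mphi phi0 phiL.
pose A : set E := [set x : V | D (- t + x)].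
have mA : measurable A by apply: measurable_shift; exact: measurable_fund.
have mphiA : measurable_fun A (fun x : E => (phi x)%:E).
  by apply: measurable_funTS; apply/measurable_EFinP.
have AD : [set x : V | A (t + x)] = D by apply/funext => x; rewrite /A /= addKr.
transitivity (\int[leb]_(x in A) (phi x)%:E)%E.
  have ephi0 (x : E) : (0 <= (phi x)%:E)%E by rewrite lee_fin.
  by rewrite (ge0_integral_shift t mA mphiA ephi0) AD.
pose f (x : E) : \bar R := (phi x * \1_D (- t + x))%:E.
have f0 x : (0 <= f x)%E by rewrite lee_fin mulr_ge0.
have mf : measurable_fun [set: E] f.
  apply/measurable_EFinP; apply: (@measurable_funM _ E R setT); first exact: mphi.
  have mI : measurable_fun [set: E] (\1_A : E -> R) by exact: measurable_indic.
  exact: mI.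
transitivity (\int[leb]_x f x)%E.
  rewrite [LHS]integral_mkcond; apply: eq_integral => x _.
  rewrite /f patchE (_ : \1_D (- t + x) = \1_A x) // indicE.
  by case: (_ \in _); rewrite ?mulr1 ?mulr0.
rewrite (ge0_integral_periodize M_unit mf f0).
apply: eq_integral => w _; rewrite -(esum_translate_fund (- t) w (phi0 w)).
by apply: eq_esum => l Ll; rewrite /f phiL.
Qed.

Hypothesis D_fin : (leb D < +oo)%E.

(** Translating by a vector [t] with [<h,t> = 1/2] changes the sign of the integrand and keeps its
    integral, which must be 0. *)
Lemma integral_exp_dual h (u : C) : dual_lattice (lattice M) h -> h != 0 ->
  (\int[leb]_(w in D) (complex.Re (u * e (dot h w)))%:E = 0)%E.
Proof.
move=> Hh h0; have mD := measurable_fund M_unit.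
pose g (w : E) := u * e (dot h w).
have mg : cmeas (setT : set E) g by apply: cmeasM; [exact: cmeas_cst|exact: cmeas_exp_dot].
pose r w := complex.Re (g w).
have mr : measurable_fun [set: E] r by case: mg.
(* Since [|u| <= 1 + |u|^2], adding [K] makes the integrand nonnegative, as
   [integral_fund_translate] demands. *)
pose K := 1 + sqmod u.
have rK w : `|r w| <= K.
  have : sqmod (g w) = sqmod u by rewrite sqmodM sqmod_expi2pi mulr1.
  rewrite /K => <-; rewrite sqmodE -/(r w) -(real_normK (num_real (r w))).
  have := sqr_ge0 (complex.Im (g w)); have := sqr_ge0 (`|r w| - 1).
  rewrite !expr2; have := normr_ge0 (r w); nra.
have rint : leb.-integrable D (fun w => (r w)%:E).
  apply: measurable_bounded_integrable => //; first exact: measurable_funTS.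
  exists K; split; first exact: num_real.
  by move=> y Ky w _; exact: le_trans (rK w) (ltW Ky).
have Kint : leb.-integrable D (fun w : E => K%:E).
  apply: measurable_bounded_integrable => //.
  exists K; split; first exact: num_real.
  have K0 : 0 <= K by rewrite /K addr_ge0 // sqmod_ge0.
  by move=> y Ky w _; rewrite /= ger0_norm // ltW.
(* The half period in the direction of [h]. *)
pose t := (2 * dot h h)^-1 *: h.
have ht : dot h t = 2^-1.
  by rewrite /t dotZr; field; rewrite gt_eqF // dot_gt0.
have rt w : r (t + w) = - r w.
  rewrite /r /g dotDr expi2piD ht expi2pi_half mulN1r mulrN.
  by case: (u * _).
have mKr : measurable_fun [set: E] (fun w : E => K + r w).
  by apply: measurable_funD => //; exact: measurable_cst.
have Kr0 w : 0 <= K + r w by have := rK w; rewrite ler_norml => /andP[]; lra.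
have KrL w l : lattice M l -> K + r (w + l) = K + r w.
  by move=> Ll; rewrite /r /g (expi2pi_dual _ Hh Ll).
have := integral_fund_translate t mKr Kr0 KrL.
under eq_integral do rewrite rt EFinD EFinN.
under [in X in _ = X -> _]eq_integral do rewrite EFinD.
rewrite integralD //; last by rewrite -/(_ \o _); exact: integrableN.
rewrite integralD // integralN; last exact: integrable_add_def.
have rfin : (\int[leb]_(w in D) (r w)%:E)%E \is a fin_num by exact: integrable_fin_num.
have Kfin : (\int[leb]_(w in D) K%:E)%E \is a fin_num by exact: integrable_fin_num.
rewrite -/(r _) -(fineK rfin) -(fineK Kfin) -EFinN -!EFinD => -[] eq0.
by congr EFin; lra.
Qed.

End exponentials_on_domain.

Section exp_system_basics.
Import complex.
Context (R : realType) (d k : nat).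
Local Notation E := (euclid R d).
Context (H : set 'cV[R]_d) (a : 'I_k -> 'cV[R]_d).
Local Notation es := (exp_system (H := H) a).

Lemma cmeas_exp_system g : cmeas (setT : set E) (es g).
Proof. exact: cmeas_exp_dot. Qed.

Lemma sqmod_exp_system g x : sqmod (es g x) = 1.
Proof. exact: sqmod_expi2pi. Qed.

Lemma exp_system_L2 (Omega : set E) g : measurable Omega ->
  (leb Omega < +oo)%E -> L2 leb Omega (es g).
Proof.
move=> mOmega Omega_fin.
split; first by apply: cmeasT; exact: cmeas_exp_system.
rewrite /nrm2; under eq_integral do rewrite sqmod_exp_system.
by rewrite integral_cst // mul1e.
Qed.

End exp_system_basics.

(** * Frame bounds for the exponential system *)

Section frame_bounds.
Import complex.
Context (R : realType) (d : nat).
Local Notation C := R[i].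
Local Notation V := 'cV[R]_d.
Local Notation E := (euclid R d).
Local Notation e := (@expi2pi R).
Context (Omega : set E) (M : 'M[R]_d) (k : nat).
Hypotheses (mOmega : measurable Omega) (Omega_gt0 : (0 < leb Omega)%E)
  (Omega_fin : (leb Omega < +oo)%E) (M_unit : M \in unitmx) (k_gt0 : (0 < k)%N)
  (tiling : multi_tiles M Omega k).
Local Notation D := (fund_domain M : set E).
Local Notation L := (lattice M).
Let mD : measurable D := measurable_fund M_unit.

(** Integrate the tiling identity over the fundamental domain: its left side is the periodization of
    the indicator of [Omega]. *)
Lemma leb_multi_tile : leb Omega = (k%:R%:E * leb D)%E.
Proof.
pose f (x : E) : \bar R := (\1_Omega x)%:E.
have mf : measurable_fun [set: E] f by apply/measurable_EFinP; exact: measurable_indic.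
have f0 x : (0 <= f x)%E by rewrite lee_fin.
have -> : leb Omega = (\int[leb]_x f x)%E by rewrite integral_indic // setIT.
rewrite (ge0_integral_periodize M_unit mf f0) -integral_cst //.
apply: (ge0_ae_eq_integral mD (measurable_esum_lattice M_unit mf f0)
  (measurable_cst _) _ _ tiling) => w _; last by rewrite lee_fin.
by apply: esum_ge0 => l _; exact: f0.
Qed.

Lemma leb_fund_fin : (leb D < +oo)%E.
Proof.
have := Omega_fin; rewrite leb_multi_tile !ltey.
by apply: contra => /eqP ->; rewrite gt0_muley // lte_fin ltr0n.
Qed.

Lemma leb_fund_gt0 : (0 < leb D)%E.
Proof.
by have := Omega_gt0; rewrite leb_multi_tile pmule_rgt0 // lte_fin ltr0n.
Qed.

Context (v : V) (n' : nat).
Local Notation n := n'.+1.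
Hypotheses (dual_v : dual_lattice L v)
  (v_sep : {ae leb, forall w : V, fund_domain M w ->
        forall l l', lattice_section M Omega w l ->
          lattice_section M Omega w l' -> l <> l' ->
          forall p q : int, dot v l = p%:~R -> dot v l' = q%:~R ->
            (p <> q %[mod n])%Z}).

(** On the lattice [dot v l] is already an integer and [floor] only changes its type; elsewhere the
    value carries no meaning. The remainder lies between 0 and [n - 1], so the casts lose
    nothing. *)
Definition residue (l : V) : 'I_n := inord `|(Num.floor (dot v l) %% n)%Z|%N.

Definition root_node (s : 'I_n) : C := e (s%:R / n%:R).

(** The quotient of two equal nodes would be [e] at a number strictly between 0 and 1. *)
Lemma root_node_inj : injective root_node.
Proof.
have lt (s t : 'I_n) : (s < t)%N -> root_node s != root_node t.
  move=> st; rewrite /root_node; apply/eqP => est.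
  have : e ((t%:R - s%:R) / n%:R) != 1.
    apply: expi2pi_neq1; rewrite divr_gt0 ?subr_gt0 ?ltr_nat //=.
    rewrite ltr_pdivrMr // mul1r ltrBlDr -natrD ltr_nat.
    by rewrite (leq_trans (ltn_ord t)) // leq_addr.
  by rewrite mulrBl expi2piD -est -expi2piD subrr expi2pi0 eqxx.
move=> s t st; apply: val_inj => /=.
by case: (ltngtP (s : nat) (t : nat)) => // /lt /eqP[].
Qed.

Lemma residueE l : L l -> exists p : int, dot v l = p%:~R /\
  (residue l : nat)%:Z = (p %% n)%Z.
Proof.
move=> Ll; have [p vl] := dual_int dual_v Ll; exists p; split => //.
have p0 : (0 <= p %% n)%Z by exact: modz_ge0.
rewrite /residue vl intrKfloor inordK ?gez0_abs //.
by rewrite -ltz_nat gez0_abs // ltz_pmod.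
Qed.

Lemma expi2pi_residue l : L l -> e (dot v l / n%:R) = root_node (residue l).
Proof.
move=> Ll; have [p [-> rp]] := residueE Ll.
rewrite [in LHS](divz_eq p n) -rp intrD intrM mulrDl expi2piD.
by rewrite -pmulrn mulfK ?pnatr_eq0 // expi2pi_int mul1r /root_node pmulrn.
Qed.

(** Chosen so that at a lattice point [l] its character equals the [j]-th power of the node of
    [residue l], as [exp_system_lattice] records. *)
Definition freq (j : 'I_k) : V := (j%:R / n%:R) *: v.
Local Notation I := (dual_lattice L * 'I_k)%type.
Local Notation es := (exp_system (H := dual_lattice L) freq).

Lemma exp_system_lattice (g : I) w l : L l ->
  es g (w + l) = es g w * root_node (residue l) ^+ g.2.
Proof.
move=> Ll; rewrite /exp_system dotDr expi2piD; congr (_ * _).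
have /set_mem Hg := valP g.1; have [p hp] := dual_int Hg Ll.
rewrite dotDl expi2piD hp expi2pi_int mulr1 dotZl -expi2pi_residue //.
by rewrite -expi2piMn; congr e; rewrite -[RHS]mulr_natl mulrAC mulrA.
Qed.

(** With the same second index the shifts [freq j] cancel in the product with the conjugate, leaving
    the character of a nonzero dual vector. *)
Lemma exp_system_orthogonal (g g' : I) : g.2 = g'.2 -> g != g' ->
  orthogonal_on leb D es g g'.
Proof.
case: g g' => [h j] [h' j'] /= <- hh' u.
rewrite -[RHS](@integral_exp_dual _ _ _ M_unit leb_fund_fin (val h - val h') u).
- apply: eq_integral => w _; rewrite /exp_system; congr ((complex.Re _)%:E).
  rewrite -mulrA; congr (_ * _).
  have conj_e t : conjc (e t) = e (- t).
    by rewrite /expi2pi mulrN cosN sinN.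
    rewrite conj_e -expi2piD -dotNl -dotDl; congr (e (dot _ _)).
  by rewrite opprD addrACA subrr add0r.
- by apply: dual_latticeD; [|apply: dual_latticeN]; apply: set_mem; exact: valP.
- rewrite subr_eq0; apply: contra hh' => /eqP/val_inj ->.
  exact: eqxx.
Qed.

Definition is_good (w : V) (F : {fset V}) :=
  [/\ lattice_section M Omega w = [set` F], #|` F| = k & {in F &, injective residue}].

Lemma in_translate w l : (l \in [set l | Omega (w + l)]) = (w + l \in Omega).
Proof. by apply/idP/idP => /set_mem ?; apply/mem_set. Qed.

(** The tiling sum counts the points of the section. No finite part of it exceeds [k], so it is
    finite and has exactly [k] elements; the separation property makes their residues distinct. *)
Lemma ae_good : {ae leb, forall w : V, D w -> exists F, is_good w F}.
Proof.
have FF := ae_filter_ringOfSetsType (@leb R d : {measure set E -> \bar R}).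
apply: (@filterS2 _ _ FF _ _ _ _ tiling v_sep) => w tw sw Dw.
have {}tw := tw Dw; have {}sw := sw Dw.
have secE (X : {fset V}) : [set` X] `<=` lattice_section M Omega w -> (#|` X| <= k)%N.
  move=> XS; rewrite -(ler_nat R) -lee_fin -tw.
  apply: esum_ge; exists [set` X]; first by split=> // l /XS[].
  rewrite fsbig_finite // set_fsetK.
  rewrite (eq_big_seq (fun=> 1%E)) => [|l lX].
    by rewrite sumEFin lee_fin big_const_seq count_predT iter_addr addr0.
  by rewrite indicE mem_set //; have [_] := XS l lX.
have [finS|infS] := pselect (finite_set (lattice_section M Omega w)); last first.
  have [X XS Xk] := infinite_set_fset k.+1 infS.
  by have := leq_trans Xk (secE X XS); rewrite ltnn.
have SE := fset_setK finS; set F := fset_set _ in SE.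
exists F; split => //.
  apply/eqP; rewrite -(eqr_nat R) -eqe -tw.
  have := esum_mkcondr L [set l | Omega (w + l)] (fun=> 1%E : \bar R).
  rewrite (_ : _ `&` _ = lattice_section M Omega w) // -SE.
  rewrite esum_fset // fsbig_finite // set_fsetK.
  rewrite sumEFin big_const_seq count_predT iter_addr addr0 => ->.
  by apply/eqP; apply: eq_esum => l _; rewrite indicE in_translate; case: ifP.
move=> l l' lF l'F ll'; apply: contrapT => nl.
have Sl : lattice_section M Omega w l by rewrite -SE.
have Sl' : lattice_section M Omega w l' by rewrite -SE.
have [p [lp rp]] := residueE Sl.1; have [q [lq rq]] := residueE Sl'.1.
by apply: (sw l l' Sl Sl' nl p q lp lq); rewrite -rp -rq ll'.
Qed.

Lemma esum_good w F (phi : V -> R) : is_good w F -> (forall l, 0 <= phi l) ->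
  (\esum_(l in L) ((\1_Omega (w + l) * phi l)%R%:E) = (\sum_(l <- F) phi l)%:E)%E.
Proof.
move=> [SF _ _] phi0.
have := esum_mkcondr L [set l | Omega (w + l)] (fun l => (phi l)%:E : \bar R).
rewrite (_ : _ `&` _ = lattice_section M Omega w) // SF.
rewrite esum_fset // => [|l _]; last by rewrite lee_fin.
rewrite fsbig_finite // set_fsetK sumEFin => ->.
apply: eq_esum => l _; rewrite indicE in_translate.
by case: ifP; rewrite ?mul1r ?mul0r.
Qed.

(** The coefficient of [z^j] in the polynomial whose values at the nodes are those of the
    combination on the fibre above [w]. *)
Definition component (c : I -> C) (F : {fset I}) (j : 'I_k) : E -> C :=
  fun w => \sum_(g <- F | g.2 == j) c g * es g w.

Lemma fcomb_component c F w l : L l ->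
  fcomb es c F (w + l) = \sum_j component c F j w * root_node (residue l) ^+ j.
Proof.
move=> Ll; rewrite /fcomb (partition_big (fun g : I => g.2) predT) //=.
apply: eq_bigr => j _; rewrite /component mulr_suml.
by apply: eq_bigr => g /eqP gj; rewrite exp_system_lattice // gj mulrA.
Qed.

Lemma cmeas_component c F j : cmeas (setT : set E) (component c F j).
Proof.
rewrite /component; under eq_fun do rewrite -big_filter.
apply: cmeas_sum => g; apply: cmeasM; first exact: cmeas_cst.
exact: cmeas_exp_system.
Qed.

Lemma component_nrm2 c F j : nrm2 leb D (component c F j) =
  (leb D * (\sum_(g <- F | g.2 == j) sqmod (c g))%:E)%E.
Proof.
rewrite [in RHS]big_fset_condE -(@orthogonal_nrm2 _ _ _ leb D mD leb_fund_fin _ es).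
- by congr nrm2; apply/funext => w; rewrite /component big_fset_condE.
- by move=> g; apply: cmeasT; exact: cmeas_exp_system.
- by move=> g x; exact: sqmod_exp_system.
move=> g g'; rewrite !inE /= => /andP[_ /eqP gj] /andP[_ /eqP gj'].
by apply: exp_system_orthogonal; rewrite gj gj'.
Qed.

Definition residues (F : {fset V}) : {set 'I_n} :=
  [set s | s \in [seq residue l | l <- F]]%SET.

Lemma card_residues w F : is_good w F -> #|residues F| = k.
Proof.
move=> [_ <- inj]; rewrite /residues cardsE.
have /card_uniqP -> : uniq [seq residue l | l <- F] by rewrite map_inj_in_uniq ?fset_uniq.
by rewrite size_map.
Qed.

Lemma sum_residues w F (phi : 'I_n -> R) : is_good w F ->
  \sum_(l <- F) phi (residue l) = \sum_(s in residues F) phi s.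
Proof.
move=> [_ _ inj]; rewrite -(big_map residue predT phi) big_uniq /=.
  by apply: eq_bigl => s; rewrite inE.
by rewrite map_inj_in_uniq ?fset_uniq.
Qed.

Lemma good_lattice w F l : is_good w F -> l \in F -> L l.
Proof.
by move=> [SF _ _] lF; have : lattice_section M Omega w l; [rewrite SF|case].
Qed.

Lemma sum_good c F w G : is_good w G ->
  \sum_(l <- G) sqmod (fcomb es c F (w + l)) = \sum_(s in residues G)
    sqmod (\sum_j component c F j w * root_node s ^+ j).
Proof.
move=> gG; rewrite -(sum_residues (fun s =>
  sqmod (\sum_j component c F j w * root_node s ^+ j)) gG).
apply: eq_big_seq => l lG; rewrite fcomb_component //.
exact: good_lattice gG lG.
Qed.

Lemma fcomb_nrm2 c F : nrm2 leb Omega (fcomb es c F) =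
  (\int[leb]_(w in D) \esum_(l in L)
    ((\1_Omega (w + l) * sqmod (fcomb es c F (w + l)))%R%:E))%E.
Proof.
pose f (x : E) : \bar R := (\1_Omega x * sqmod (fcomb es c F x))%:E.
have mcomb : cmeas (setT : set E) (fcomb es c F).
  by apply: cmeas_sum => g; apply: cmeasM; [exact: cmeas_cst|exact: cmeas_exp_system].
have mf : measurable_fun [set: E] f.
  apply/measurable_EFinP; apply: measurable_funM; first exact: measurable_indic.
  exact: measurable_sqmod.
have f0 x : (0 <= f x)%E by rewrite lee_fin mulr_ge0 // sqmod_ge0.
rewrite -(ge0_integral_periodize M_unit mf f0) /nrm2 integral_mkcond.
apply: eq_integral => x _; rewrite patchE /f indicE.
by case: (_ \in _); rewrite ?mul1r ?mul0r.
Qed.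

(** Parseval's identity on the fundamental domain for each [j], summed over [j]. *)
Lemma component_sum c F :
  (\int[leb]_(w in D) (\sum_j sqmod (component c F j w))%:E =
   leb D * (\sum_(g <- F) sqmod (c g))%:E)%E.
Proof.
have mq j : measurable_fun D (fun w => (sqmod (component c F j w))%:E).
  by apply: measurable_esqmod; apply: cmeasT; exact: cmeas_component.
have q0 j w : D w -> (0 <= (sqmod (component c F j w))%:E)%E.
  by move=> _; rewrite lee_fin sqmod_ge0.
under eq_integral do rewrite -sumEFin.
rewrite (ge0_integral_sum _ mD mq q0).
under eq_bigr do rewrite -/(nrm2 leb D _) component_nrm2.
rewrite -ge0_sume_distrr => [|j _]; last first.
  by rewrite lee_fin sumr_ge0 // => g _; exact: sqmod_ge0.
by rewrite sumEFin [in RHS](partition_big (fun g : I => g.2) predT).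
Qed.

(** At almost every [w] the fibre sum [Psi w] lies between [B^-1 * Phi w], by interpolation, and
    [K * Phi w], by direct estimation. Integrating over the fundamental domain and using
    [component_sum] gives both bounds. *)
Lemma exp_system_frame : exists A0 K : R, [/\ 0 < A0, 0 < K &
  forall c (F : {fset I}),
    ((A0 * \sum_(g <- F) sqmod (c g))%:E <= nrm2 leb Omega (fcomb es c F))%E /\
    (nrm2 leb Omega (fcomb es c F) <= (K * \sum_(g <- F) sqmod (c g))%:E)%E].
Proof.
have [B B0 HB] := interpolation_bound k root_node_inj.
have Dfn : leb D \is a fin_num by rewrite ge0_fin_numE ?leb_fund_fin.
pose m := fine (leb D); have mE : leb D = m%:E by rewrite /m fineK.
have m0 : 0 < m by rewrite -lte_fin -mE leb_fund_gt0.
(* There are [k] points on the fibre, and at each of them [sqmod_sum_le] over the [k] components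
   costs [2 ^+ k]; the nodes have modulus 1. *)
pose K := k%:R * 2 ^+ k : R.
have K0 : 0 < K by rewrite mulr_gt0 ?ltr0n ?exprn_gt0.
exists (B^-1 * m), (K * m); split; [by rewrite mulr_gt0 ?invr_gt0|by rewrite mulr_gt0|].
move=> c F.
pose Psi w : \bar R := (\esum_(l in L)
    ((\1_Omega (w + l) * sqmod (fcomb es c F (w + l)))%R%:E))%E.
pose Phi w : R := \sum_j sqmod (component c F j w).
have Phi0 w : 0 <= Phi w by apply: sumr_ge0 => j _; exact: sqmod_ge0.
have ePhi0 w (a : R) : 0 <= a -> (0 <= (a * Phi w)%:E)%E.
  by move=> a0; rewrite lee_fin mulr_ge0.
have Psi0 w : (0 <= Psi w)%E.
  by apply: esum_ge0 => l _; rewrite lee_fin mulr_ge0 // sqmod_ge0.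
have mPsi : measurable_fun D Psi.
  apply: (measurable_esum_lattice M_unit (f := fun x : E =>
    (\1_Omega x * sqmod (fcomb es c F x))%:E)).
    apply/measurable_EFinP; apply: measurable_funM; first exact: measurable_indic.
    apply: measurable_sqmod; apply: cmeas_sum => g.
    by apply: cmeasM; [exact: cmeas_cst|exact: cmeas_exp_system].
  by move=> x; rewrite lee_fin mulr_ge0 // sqmod_ge0.
have mPhi : measurable_fun D Phi.
  apply: (@measurable_sum _ E R D) => j; apply: measurable_sqmod.
  by apply: cmeasT; exact: cmeas_component.
have maPhi a : measurable_fun D (fun w => (a * Phi w)%:E).
  apply/measurable_EFinP; apply: measurable_funM => //; exact: measurable_cst.
have intPhi a : 0 <= a ->
    (\int[leb]_(w in D) (a * Phi w)%:E = (a * m * \sum_(g <- F) sqmod (c g))%:E)%E.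
  have mPhiE : measurable_fun D (fun w => (Phi w)%:E) by apply/measurable_EFinP.
  have PhiE0 w : D w -> (0 <= (Phi w)%:E)%E by move=> _; rewrite lee_fin.
  move=> a0; under eq_integral do rewrite EFinM.
  rewrite (ge0_integralZl_EFin _ mD PhiE0 mPhiE a0).
  by rewrite component_sum mE -!EFinM mulrA.
have iB0 : 0 <= B^-1 by rewrite invr_ge0 ltW.
have ge0P w : D w -> (0 <= Psi w)%E by [].
have ge0B w : D w -> (0 <= (B^-1 * Phi w)%:E)%E by move=> _; exact: ePhi0.
have ge0K w : D w -> (0 <= (K * Phi w)%:E)%E by move=> _; apply: ePhi0; exact: ltW.
have FF := ae_filter_ringOfSetsType (@leb R d : {measure set E -> \bar R}).
have PsiE w G : is_good w G -> Psi w = (\sum_(s in residues G)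
    sqmod (\sum_j component c F j w * root_node s ^+ j))%:E.
  move=> gG; rewrite -sum_good // -(esum_good gG (phi := fun l =>
    sqmod (fcomb es c F (w + l)))) // => l; exact: sqmod_ge0.
rewrite fcomb_nrm2 -/(Psi _); split.
- rewrite -(intPhi _ iB0).
  apply: (ae_ge0_le_integral mD ge0B (maPhi _) ge0P mPsi).
  apply: (@filterS _ _ FF _ _ _ ae_good) => w /[apply] -[G gG].
  rewrite (PsiE _ _ gG) lee_fin mulrC ler_pdivrMr // mulrC.
  by apply: HB; exact: card_residues gG.
- rewrite -(intPhi _ (ltW K0)).
  apply: (ae_ge0_le_integral mD ge0P mPsi ge0K (maPhi _)).
  apply: (@filterS _ _ FF _ _ _ ae_good) => w /[apply] -[G gG].
  rewrite (PsiE _ _ gG) lee_fin.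
  apply: (@le_trans _ _ (\sum_(s in residues G) 2 ^+ k * Phi w)).
    apply: ler_sum => s _; apply: le_trans (sqmod_sum_le _ _) _.
    rewrite -[index_enum _]enumT size_enum_ord ler_wpM2l ?exprn_ge0 //.
    rewrite enumT; apply: ler_sum => j _; rewrite sqmodM /root_node.
    by rewrite -expi2piMn sqmod_expi2pi mulr1.
  by rewrite sumr_const (card_residues gG) -[leLHS]mulr_natl mulrA.
Qed.

End frame_bounds.

(** * Periodic multipliers *)

Section reduction_map.
Context (R : realType) (d : nat).
Local Notation V := 'cV[R]_d.
Local Notation E := (euclid R d).
Context (M : 'M[R]_d).
Hypothesis M_unit : M \in unitmx.
Local Notation D := (fund_domain M : set E).
Local Notation L := (lattice M).
Local Notation redM := (red M : E -> E).

Lemma measurable_bigcup_lattice (F : 'cV[int]_d -> set E) :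
  (forall z, measurable (F z)) -> measurable (\bigcup_z F z).
Proof. exact: countable_bigcupT_measurable. Qed.

Lemma measurable_red (A : set E) : measurable A -> measurable (redM @^-1` A).
Proof.
move=> mA.
rewrite (_ : _ @^-1` _ = \bigcup_z ([set x : V | zfloor M x = z] `&`
   [set x : V | A (- lat M z + x)])).
  apply: measurable_bigcup_lattice => z; apply: measurableI.
    exact: measurable_zfloor.
  exact: measurable_shift.
apply/seteqP; split => x /=.
  by exists (zfloor M x) => //; split; rewrite //= addrC.
by move=> [z _ [/= <-]]; rewrite addrC.
Qed.

(** The periodization of a null set is null. This transports statements valid almost everywhere on
    the fundamental domain to the whole space. *)
Lemma negligible_red (N : set E) : measurable N -> leb N = 0%E ->
  leb (redM @^-1` N) = 0%E.
Proof.
move=> mN N0; have mrN := measurable_red mN.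
pose f (x : E) : \bar R := (\1_(redM @^-1` N) x)%:E.
have mf : measurable_fun [set: E] f by apply/measurable_EFinP; exact: measurable_indic.
have f0 x : (0 <= f x)%E by rewrite lee_fin.
have -> : leb (redM @^-1` N) = (\int[leb]_x f x)%E by rewrite integral_indic // setIT.
rewrite (ge0_integral_periodize M_unit mf f0).
rewrite -[RHS](integral0 leb D).
apply: (ge0_ae_eq_integral (measurable_fund M_unit)
  (measurable_esum_lattice M_unit mf f0) (measurable_cst _)) => [w _|w _|] //.
  by apply: esum_ge0 => l _; exact: f0.
exists N; split => // w /= /not_implyP[Dw]; apply: contra_notP => Nw.
apply: esum1 => l Ll; rewrite /f indicE memNset // /preimage /mkset red_lattice //.
by rewrite redE.
Qed.

End reduction_map.

Section periodic_multipliers.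
Import complex.
Context (R : realType) (d : nat).
Local Notation C := R[i].
Local Notation V := 'cV[R]_d.
Local Notation E := (euclid R d).
Local Notation e := (@expi2pi R).
Local Notation rc := (real_complex R).
Context (Omega : set E) (M : 'M[R]_d) (k : nat) (a : 'I_k -> V).
Hypotheses (mOmega : measurable Omega) (Omega_fin : (leb Omega < +oo)%E)
  (M_unit : M \in unitmx).
Local Notation D := (fund_domain M : set E).
Local Notation L := (lattice M).
Local Notation I := (dual_lattice L * 'I_k)%type.
Local Notation es := (exp_system (H := dual_lattice L) a).
Local Notation mult := (multiplier leb Omega es).
Local Notation rmult := (rmultiplier leb Omega es).
Local Notation redM := (red M : E -> E).
Let esL2 g : L2 leb Omega (es g) := exp_system_L2 a g mOmega Omega_fin.

(** Multiplication by the character of [h] permutes the exponential system: it sends the index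
    [(h', j)] to [(h + h', j)]. *)
Lemma multiplier_exp h : dual_lattice L h -> mult (fun x : E => e (dot h x)).
Proof.
move=> Hh; apply: (@multiplier_span _ _ _ _ _ mOmega _ _ esL2 _ 1).
- exact: cmeas_exp_dot.
- by move=> x; rewrite sqmod_expi2pi.
move=> _ [s ->].
pose tr (g : I) : I := (exist _ (h + val g.1)
  (mem_set (dual_latticeD Hh (set_mem (valP g.1)))), g.2).
exists [seq (p.1, tr p.2) | p <- s].
apply/funext => x; rewrite big_map mulr_sumr; apply: eq_bigr => p _ /=.
rewrite mulrCA; congr (_ * _); rewrite /exp_system -expi2piD -dotDl.
by congr (e (dot _ _)); rewrite addrCA.
Qed.

Lemma rmultiplier_cos h : dual_lattice L h ->
  rmult (fun x : E => cos (2 * pi * dot h x)).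
Proof.
move=> Hh; have m1 := multiplier_exp Hh.
have m2 := multiplier_exp (dual_latticeN Hh).
have := multiplierM (multiplier_cst mOmega esL2 (rc 2^-1)) (multiplierD mOmega esL2 m1 m2).
rewrite /rmultiplier; congr mult; apply/funext => x.
rewrite dotNl /expi2pi mulrN cosN sinN; apply/eqP; rewrite eq_complex /=.
by apply/andP; split; apply/eqP; field.
Qed.

Lemma rmultiplier_sin h : dual_lattice L h ->
  rmult (fun x : E => sin (2 * pi * dot h x)).
Proof.
move=> Hh; have m1 := multiplier_exp Hh.
have m2 := multiplier_exp (dual_latticeN Hh).
have := multiplierD mOmega esL2
  (multiplierM (multiplier_cst mOmega esL2 (Complex 0 (- 2^-1))) m1)
  (multiplierM (multiplier_cst mOmega esL2 (Complex 0 2^-1)) m2).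
rewrite /rmultiplier; congr mult; apply/funext => x.
rewrite dotNl /expi2pi mulrN cosN sinN; apply/eqP; rewrite eq_complex /=.
by apply/andP; split; apply/eqP; field.
Qed.

(* As [red] takes its values in the fundamental domain, membership only depends
   on the trace of the set there. *)
Definition periodic_sets : set (set E) :=
  [set A | rmult (fun x => \1_A (redM x))].

Lemma periodic_setsC A : periodic_sets A -> periodic_sets (~` A).
Proof.
move=> mA; rewrite /periodic_sets /=.
rewrite (_ : (fun _ => _) = fun x => 1 + -1 * \1_A (redM x)).
  exact: (rmultiplierD mOmega esL2 (rmultiplier_cst mOmega esL2 1)
    (rmultiplierM (rmultiplier_cst mOmega esL2 (-1)) mA)).
by apply/funext => x; rewrite !indicE in_setC; case: (_ \in _); rewrite /= ?mulr1 ?mulr0; ring.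
Qed.

Lemma periodic_setsI A B : periodic_sets A -> periodic_sets B ->
  periodic_sets (A `&` B).
Proof.
move=> mA mB; rewrite /periodic_sets /=.
rewrite (_ : (fun _ => _) = fun x => \1_A (redM x) * \1_B (redM x)).
  exact: (rmultiplierM mA mB).
by apply/funext => x; rewrite indicI.
Qed.

Lemma periodic_setsU A B : periodic_sets A -> periodic_sets B ->
  periodic_sets (A `|` B).
Proof.
move=> mA mB; rewrite -[A `|` B]setCK setCU.
by apply/periodic_setsC/periodic_setsI; exact: periodic_setsC.
Qed.

Lemma periodic_set0 : periodic_sets set0.
Proof.
rewrite /periodic_sets /=; under eq_fun do rewrite indic0.
exact: (rmultiplier_cst mOmega esL2).
Qed.

(** Multipliers form an algebra, which handles complements and intersections. The indicator of a
    countable union is the bounded pointwise limit of those of the finite unions. *)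
Lemma periodic_sets_sigma_algebra : sigma_algebra setT periodic_sets.
Proof.
split; [exact: periodic_set0|by move=> A mA; rewrite setTD; exact: periodic_setsC|].
move=> A mA.
apply: (@rmultiplier_lim _ _ _ _ _ mOmega _ _ esL2
  (fun m x => \1_(\big[setU/set0]_(i < m) A i) (redM x)) _ 1).
- elim=> [|m IH]; first by rewrite big_ord0; exact: periodic_set0.
  by rewrite big_ord_recr; exact: periodic_setsU.
- by move=> m x; rewrite indicE normr_nat lern1 leq_b1.
- move=> x; rewrite [in X in _ --> X]indicE.
  case: (boolP (redM x \in _)) => [/set_mem[i _ Ai]|nA].
    apply: (@cvg_near_cst _ _ _ _ _); exists i.+1 => // m /= im.
    rewrite indicE mem_set // -bigcup_mkord; exists i => //.
  apply: cvg_near_cst; near=> m.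
  rewrite indicE memNset // -bigcup_mkord => -[i _ Ai].
  by move: nA; rewrite notin_setE; apply; exists i.
Unshelve. all: by end_near. Qed.

Lemma periodic_sets_eq (A B : set E) : periodic_sets A ->
  (forall x, D x -> A x <-> B x) -> periodic_sets B.
Proof.
move=> mA AB; rewrite /periodic_sets /=; have /= := mA.
congr rmult; apply/funext => x; rewrite !indicE.
have [AB1 BA1] := AB _ (red_fund M_unit x).
suff -> : (redM x \in A) = (redM x \in B) by [].
by apply/idP/idP => /set_mem ?; apply/mem_set; auto.
Qed.

End periodic_multipliers.

(** * The order on [[0,1)] read from signs of sine and cosine *)

Section half_turns.
Context (R : realType).
Implicit Types c t : R.

Lemma sin_turn_lt0 t : 0 <= t < 1 -> (sin (2 * pi * t) < 0) = (2^-1 < t).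
Proof.
move=> /andP[t0 t1]; have p0 := pi_gt0 R; case: (ltP 2^-1 t) => [t2|t2].
  rewrite -[sin _]opprK -sinDpi oppr_lt0.
  rewrite (_ : 2 * pi * t + pi = (2 * pi * t - pi) + pi *+ 2); last by rewrite mulr2n; ring.
  by rewrite sinD2pi; apply: sin_gt0_pi; apply/andP; split; nra.
by apply/negbTE; rewrite -leNgt; apply: sin_ge0_pi; apply/andP; split; nra.
Qed.

Lemma cos_turn_lt c t : 0 <= c <= 2^-1 -> 0 <= t <= 2^-1 ->
  (cos (2 * pi * t) < cos (2 * pi * c)) = (c < t).
Proof.
move=> /andP[c0 c1] /andP[t0 t1]; have p0 := pi_gt0 R.
rewrite ltr_cos ?in_itv /=; [|apply/andP; split; nra|apply/andP; split; nra].
by rewrite ltr_pM2l // mulr_gt0.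
Qed.

Lemma cos_turnB t : cos (2 * pi * (1 - t)) = cos (2 * pi * t).
Proof.
rewrite (_ : 2 * pi * (1 - t) = - (2 * pi * t) + pi *+ 2); last by rewrite mulr2n; ring.
by rewrite cosD2pi cosN.
Qed.

(** A negative sine means the second half turn, which lies beyond [c]; on the first half the cosine
    decreases, so comparing cosines reverses the order. *)
Lemma turn_gt_low c t : 0 <= c <= 2^-1 -> 0 <= t < 1 -> (c < t) =
  (sin (2 * pi * t) < 0) || (cos (2 * pi * t) < cos (2 * pi * c)).
Proof.
move=> cI tI; rewrite sin_turn_lt0 //; case: (ltP 2^-1 t) => [t2|t2] /=.
  by case/andP: cI => _ /le_lt_trans; apply.
by rewrite cos_turn_lt //; case/andP: tI => ->.
Qed.

(** Now [t] must lie in the second half turn, where the cosine increases. *)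
Lemma turn_gt_high c t : 2^-1 < c < 1 -> 0 <= t < 1 -> (c < t) =
  (sin (2 * pi * t) < 0) && (cos (2 * pi * c) < cos (2 * pi * t)).
Proof.
move=> /andP[c2 c1] /andP[t0 t1]; rewrite sin_turn_lt0 ?t0 //.
case: (ltP 2^-1 t) => [t2|t2] /=; last first.
  by apply/negbTE; rewrite -leNgt (le_trans t2) // ltW.
rewrite -(cos_turnB c) -(cos_turnB t) cos_turn_lt.
- by rewrite ltrD2l ltrN2.
- by apply/andP; split; lra.
- by apply/andP; split; lra.
Qed.

End half_turns.

(** * From trigonometric multipliers to all bounded measurable periodic ones *)

Section periodic_measurable.
Import complex.
Context (R : realType) (d : nat).
Local Notation C := R[i].
Local Notation V := 'cV[R]_d.
Local Notation E := (euclid R d).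
Local Notation e := (@expi2pi R).
Local Notation rc := (real_complex R).
Context (Omega : set E) (M : 'M[R]_d) (k : nat) (a : 'I_k -> V).
Hypotheses (mOmega : measurable Omega) (Omega_fin : (leb Omega < +oo)%E)
  (M_unit : M \in unitmx) (D_fin : (leb (fund_domain M : set E) < +oo)%E).
Local Notation D := (fund_domain M : set E).
Local Notation L := (lattice M).
Local Notation I := (dual_lattice L * 'I_k)%type.
Local Notation es := (exp_system (H := dual_lattice L) a).
Local Notation mult := (multiplier leb Omega es).
Local Notation rmult := (rmultiplier leb Omega es).
Local Notation redM := (red M : E -> E).
Local Notation S := (periodic_sets Omega M a).
Let esL2 g : L2 leb Omega (es g) := exp_system_L2 a g mOmega Omega_fin.
Let sigS : sigma_algebra setT S := periodic_sets_sigma_algebra M a mOmega Omega_fin.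

Lemma periodic_sets_gt (u : V -> R) c : rmult (u : E -> R) ->
  (forall x, u (redM x) = u x) -> S [set x : V | c < u x].
Proof.
move=> mu uL; have := rmultiplier_gt mOmega esL2 c mu.
rewrite /periodic_sets /=; congr rmult; apply/funext => x; rewrite !indicE.
suff -> : (redM x \in [set x : V | c < u x]) = (x \in [set x : V | c < u x]) by [].
by apply/idP/idP => /set_mem /= ?; apply/mem_set => /=; rewrite ?uL // -uL.
Qed.

(** Row [i] of the inverse matrix: the basis of the dual lattice dual to the columns of [M]. *)
Definition dual_basis i : V := \col_j invmx M i j.

Lemma dot_dual_basis i x : dot (dual_basis i) x = (invmx M *m x) i 0.
Proof. by rewrite /dot mxE; apply: eq_bigr => j _; rewrite mxE. Qed.

Lemma dual_dual_basis i : dual_lattice L (dual_basis i).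
Proof.
by move=> l /latticeP[z ->]; rewrite dot_dual_basis mulKmx // mxE intr_int.
Qed.

Lemma expi2pi_red h x : dual_lattice L h -> e (dot h (redM x)) = e (dot h x).
Proof.
by move=> Hh; rewrite -[in RHS](redK M x) (expi2pi_dual _ Hh) //; exact: lattice_lat.
Qed.

(** The coordinate is not periodic, but on the fundamental domain it lies in [[0,1)], where its
    order is expressed by sines and cosines of dual characters. Outside [0 <= c < 1] the trace on
    the domain is everything or empty. *)
Lemma periodic_sets_coord i c : S [set x : V | c < (invmx M *m x) i 0].
Proof.
have Hb := dual_dual_basis i.
pose t x := dot (dual_basis i) x.
have tE x : (invmx M *m x) i 0 = t x by rewrite /t dot_dual_basis.
have t01 x : D x -> 0 <= t x < 1.
  by move=> [y y01 <-]; rewrite /t dot_dual_basis mulKmx.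
have mcos : rmult (fun x : E => cos (2 * pi * t x)).
  exact: (rmultiplier_cos a mOmega Omega_fin Hb).
have msin : rmult (fun x : E => sin (2 * pi * t x)).
  exact: (rmultiplier_sin a mOmega Omega_fin Hb).
have pcos x : cos (2 * pi * t (redM x)) = cos (2 * pi * t x).
  by have /(congr1 (@complex.Re R)) := expi2pi_red x Hb.
have psin x : sin (2 * pi * t (redM x)) = sin (2 * pi * t x).
  by have /(congr1 (@complex.Im R)) := expi2pi_red x Hb.
have mN (u : E -> R) : rmult u -> rmult (fun x => -1 * u x).
  move=> mu; exact: (rmultiplierM (rmultiplier_cst mOmega esL2 (-1)) mu).
have Ssin : S [set x : V | 0 < -1 * sin (2 * pi * t x)].
  by apply: periodic_sets_gt; [exact: mN|move=> x; rewrite psin].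
have Scos1 b : S [set x : V | b < cos (2 * pi * t x)].
  exact: periodic_sets_gt.
have Scos2 b : S [set x : V | - b < -1 * cos (2 * pi * t x)].
  by apply: periodic_sets_gt; [exact: mN|move=> x; rewrite pcos].
have m0 : S set0 by exact: (periodic_set0 M a mOmega Omega_fin).
have mT : S setT.
  by rewrite -setC0; exact: (periodic_setsC mOmega Omega_fin m0).
have [c0|c0] := ltP c 0.
  apply: (periodic_sets_eq M_unit mT) => x Dx; split=> //= _.
  by rewrite tE (lt_le_trans c0) //; case/andP: (t01 x Dx).
have [c1|c1] := leP 1 c.
  apply: (periodic_sets_eq M_unit m0) => x Dx; split=> //=.
  by rewrite tE => /(le_lt_trans c1); rewrite ltNge ltW //; case/andP: (t01 x Dx).
have [c2|c2] := leP c 2^-1.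
  have SU := periodic_setsU mOmega Omega_fin Ssin (Scos2 (cos (2 * pi * c))).
  apply: (periodic_sets_eq M_unit SU) => x Dx.
  rewrite /setU /mkset tE (@turn_gt_low _ c) ?t01 ?c0 // !mulN1r oppr_gt0 ltrN2.
  by split => /orP.
have SI := periodic_setsI Ssin (Scos1 (cos (2 * pi * c))).
apply: (periodic_sets_eq M_unit SI) => x Dx.
rewrite /setI /mkset tE (@turn_gt_high _ c) ?t01 ?c2 // !mulN1r oppr_gt0.
by split => /andP.
Qed.

Local Notation TS := (g_sigma_algebraType S).

Lemma measurable_TS (A : set TS) : measurable A = S A.
Proof. by rewrite -[in RHS](sigma_algebra_id sigS). Qed.

(** The coordinates of [M^-1 x] are measurable for the sigma-algebra [S], hence so are those of [x],
    which are linear combinations of them; the Borel sets follow. *)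
Lemma periodic_sets_borel (G : set (d.-tuple (measurableTypeR R))) :
  measurable G -> S (@tuple_of_col R d @^-1` G).
Proof.
move=> mG; rewrite -measurable_TS -[_ @^-1` _]setTI.
suff mt : measurable_fun [set: TS] (@tuple_of_col R d : TS -> d.-tuple (measurableTypeR R)).
  exact: mt.
apply/measurable_fun_tnthP => j.
have mcoord i : measurable_fun [set: TS] (fun x : V => (invmx M *m x) i 0).
  move=> _; apply: (measurability _ (RGenOInfty.measurableE R)) => // _ [_ [c ->] <-].
  rewrite setTI preimage_itvoy measurable_TS; exact: periodic_sets_coord.
rewrite (_ : _ \o _ = fun x : V => \sum_i M j i * (invmx M *m x) i 0); last first.
  apply/funext => x; rewrite /= tnth_mktuple.
  by rewrite -[in LHS](mulKVmx M_unit x) mxE.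
apply: (@measurable_sum _ TS R setT _ _ (fun i (x : V) => M j i * (invmx M *m x) i 0)).
move=> i; apply: (@measurableT_comp _ _ _ TS _ _ ( *%R (M j i))).
  exact: mulrl_measurable.
exact: mcoord.
Qed.

(** The periodized indicator vanishes almost everywhere, so multiplying by it gives a function
    almost everywhere 0, which lies in the closed span. *)
Lemma periodic_sets_null (N : set E) : measurable N -> leb N = 0%E -> S N.
Proof.
move=> mN N0; have mrN := measurable_red M mN.
have mw : cmeas (setT : set E) (fun x => rc (\1_N (redM x))).
  apply: cmeas_real; rewrite (_ : (fun _ => _) = \1_(redM @^-1` N)).
    exact: measurable_indic.
  by apply/funext => x; rewrite !indicE.
split; first exact: mw.
  exists 1 => x; rewrite sqmodC indicE; case: (_ \in _); first by rewrite expr1n.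
  by rewrite expr0n.
have mw' : cmeas Omega (fun x : E => rc (\1_N (redM x))) by exact: cmeasT mw.
move=> f sf; have mf : cmeas Omega f by case: (closed_span_L2 sf).
have s0 : closed_span leb Omega es (fun=> 0).
  by apply: (lin_closed_span mOmega esL2); exists [::]; apply/funext => x; rewrite big_nil.
apply: (closed_span_ae mOmega esL2 s0 (cmeasM mw' mf)).
exists (redM @^-1` N); split; [exact: mrN|exact: negligible_red|].
move=> x /= /not_implyP[_]; apply: contra_notP => Nx.
by rewrite indicE memNset // rmorph0 mul0r.
Qed.

(** Only the trace on the fundamental domain matters. It has finite measure, hence a Borel hull,
    from which it differs by a null set. *)
Lemma periodic_sets_measurable (A : set E) : measurable A -> S A.
Proof.
move=> mA; have mD := measurable_fund M_unit.
have mAD : measurable (A `&` D) by exact: measurableI.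
have ADfin : (leb (A `&` D) < +oo)%E.
  by apply: le_lt_trans D_fin; apply: le_outer_measure; exact: subIsetr.
have [G [mG AG lG]] := outer_cover ADfin.
pose B : set E := @tuple_of_col R d @^-1` G.
have mB : measurable B.
  by rewrite -[B]setTI; exact: measurable_tuple_of_col.
have mBA : measurable (B `\` (A `&` D)) by exact: measurableD.
have N0 : leb (B `\` (A `&` D)) = 0%E.
  have lB : leb B = leb (A `&` D) by exact: lG.
  have Bfin : (leb B < +oo)%E by rewrite lB.
  have := measureD mB mAD Bfin; rewrite (setIidr AG) => BA; apply: (etrans BA).
  rewrite -[X in (X - _)%E]/(leb B) lB subee //.
  by rewrite ge0_fin_numE //; exact: measure_ge0.
have SB := periodic_sets_borel mG.
have SN := periodic_setsC mOmega Omega_fin (periodic_sets_null mBA N0).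
apply: (periodic_sets_eq M_unit (periodic_setsI SB SN)) => x Dx; split.
  by move=> [Bx nx]; apply: contrapT => nA; apply: nx; split => // -[].
by move=> Ax; split; [exact: AG|move=> [_]; apply].
Qed.

Lemma rmultiplier_red (phi : E -> R) K : measurable_fun setT phi ->
  (forall x, `|phi x| <= K) -> rmult (fun x => phi (redM x)).
Proof.
move=> mphi phiK.
apply: (@bounded_measurable_ind R _ E (fun f => rmult (fun x => f (redM x)))
  periodic_sets_measurable _ _ _ phi K mphi phiK).
- move=> f g mf mg; exact: (rmultiplierD mOmega esL2 mf mg).
- move=> c f mf; exact: (rmultiplierM (rmultiplier_cst mOmega esL2 c) mf).
- move=> f_ f K' mf_ fK ff.
  exact: (rmultiplier_lim mOmega esL2 mf_ (fun m x => fK m (redM x)) (fun x => ff (redM x))).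
Qed.

Lemma multiplier_red (w : E -> C) K : cmeas setT w ->
  (forall x, sqmod (w x) <= K) -> mult (fun x => w (redM x)).
Proof.
move=> [mr mi] wK.
have bnd (r s : R) : r ^+ 2 + s ^+ 2 <= K -> `|r| <= 1 + K /\ `|s| <= 1 + K.
  rewrite -(real_normK (num_real r)) -(real_normK (num_real s)).
  have := sqr_ge0 (`|r| - 1); have := sqr_ge0 (`|s| - 1).
  by have := normr_ge0 r; have := normr_ge0 s; rewrite !expr2; split; nra.
have rK x : `|complex.Re (w x)| <= 1 + K.
  by have := wK x; rewrite sqmodE => /bnd[].
have iK x : `|complex.Im (w x)| <= 1 + K.
  by have := wK x; rewrite sqmodE => /bnd[].
have m1 := rmultiplier_red mr rK; have m2 := rmultiplier_red mi iK.
have := multiplierD mOmega esL2 m1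
  (multiplierM (multiplier_cst mOmega esL2 (Complex 0 1)) m2).
congr mult; apply/funext => x; case: (w _) => r s.
by apply/eqP; rewrite eq_complex /=; apply/andP; split; apply/eqP; ring.
Qed.

End periodic_measurable.

(** * Density *)

Section density.
Import complex.
Context (R : realType) (d : nat).
Local Notation C := R[i].
Local Notation V := 'cV[R]_d.
Local Notation E := (euclid R d).
Local Notation e := (@expi2pi R).
Local Notation rc := (real_complex R).
Context (Omega : set E) (M : 'M[R]_d) (k : nat).
Hypotheses (mOmega : measurable Omega) (Omega_gt0 : (0 < leb Omega)%E)
  (Omega_fin : (leb Omega < +oo)%E) (M_unit : M \in unitmx) (k_gt0 : (0 < k)%N)
  (tiling : multi_tiles M Omega k).
Local Notation D := (fund_domain M : set E).
Local Notation L := (lattice M).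
Context (v : V) (n' : nat).
Local Notation n := n'.+1.
Hypotheses (dual_v : dual_lattice L v)
  (v_sep : {ae leb, forall w : V, fund_domain M w ->
        forall l l', lattice_section M Omega w l ->
          lattice_section M Omega w l' -> l <> l' ->
          forall p q : int, dot v l = p%:~R -> dot v l' = q%:~R ->
            (p <> q %[mod n])%Z}).
Local Notation I := (dual_lattice L * 'I_k)%type.
Local Notation a := (@freq R d k v n').
Local Notation es := (exp_system (H := dual_lattice L) a).
Local Notation redM := (red M : E -> E).
Local Notation res := (residue v n').
Local Notation cspan := (closed_span leb Omega es).
Let esL2 g : L2 leb Omega (es g) := exp_system_L2 a g mOmega Omega_fin.
Let D_fin : (leb D < +oo)%E := leb_fund_fin mOmega Omega_fin M_unit k_gt0 tiling.

Lemma red_good : {ae leb, forall x : V,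
  exists F, is_good Omega M k v n' (redM x) F}.
Proof.
have [N [mN N0 goodN]] := ae_good tiling dual_v v_sep.
exists (redM @^-1` N); split; [exact: measurable_red|exact: negligible_red|].
move=> x nx; apply: goodN => good; apply: nx; apply: good.
exact: red_fund.
Qed.

Definition own_residue (x : V) : 'I_n := res (x - redM x).

(** The residues met by [Omega] on the fibre of [x]. Defined at every [x]; at a good point it
    coincides with [residues F] and has [k] elements. *)
Definition orbit_residues (x : V) : {set 'I_n} :=
  [set s | `[< exists l, [/\ L l, Omega (redM x + l) & res l = s] >]]%SET.

Lemma orbit_residuesP x s : reflect (exists l, [/\ L l, Omega (redM x + l) & res l = s])
  (s \in orbit_residues x).
Proof. by rewrite inE; exact: asboolP. Qed.

Lemma measurable_own_residue s : measurable ([set x : V | own_residue x = s] : set E).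
Proof.
rewrite (_ : mkset _ = \bigcup_z ([set x : V | zfloor M x = z] `&`
    (if res (lat M z) == s then setT else set0 : set E))).
  apply: measurable_bigcup_lattice => z; apply: measurableI.
    exact: measurable_zfloor.
  by case: eqP => _; [exact: measurableT|exact: measurable0].
have ownE x : own_residue x = res (lat M (zfloor M x)).
  by rewrite /own_residue; congr res; rewrite -[X in X - _](redK M x) addrAC subrr add0r.
apply/seteqP; split => x /=; rewrite ownE.
  by move=> xs; exists (zfloor M x) => //; split => //=; rewrite xs eqxx.
by move=> [z _ [/= -> ]]; case: eqP.
Qed.

Lemma measurable_mem_orbit_residues s :
  measurable ([set x : V | s \in orbit_residues x] : set E).
Proof.
pose W : set E := \bigcup_z ((if res (lat M z) == s then setT else set0 : set E)
   `&` [set w : V | Omega (lat M z + w)]).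
have mW : measurable W.
  apply: measurable_bigcup_lattice => z; apply: measurableI.
    by case: eqP => _; [exact: measurableT|exact: measurable0].
  exact: measurable_shift.
rewrite (_ : mkset _ = redM @^-1` W); first exact: measurable_red.
apply/seteqP; split => x /=.
  move=> /orbit_residuesP[l [/latticeP[z ->] Ol rl]]; exists z => //; split.
    by rewrite rl eqxx.
  by rewrite /= addrC.
move=> [z _ [+ /= Oz]]; case: eqP => // rz _; apply/orbit_residuesP.
by exists (lat M z); split; [exact: lattice_lat|rewrite addrC|].
Qed.

Lemma measurable_orbit_residues (T : {set 'I_n}) :
  measurable ([set x : V | orbit_residues x = T] : set E).
Proof.
pose B s : set E := [set x : V | s \in orbit_residues x].
rewrite (_ : mkset _ = \bigcap_(s in [set: 'I_n]) (if s \in T then B s else ~` B s)).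
  apply: fin_bigcap_measurable => [|s _]; first exact: finite_finset.
  case: ifP => _; [|apply: measurableC]; exact: measurable_mem_orbit_residues.
apply/seteqP; split => x /=.
  by move=> <- s _; rewrite /B; case: ifPn => //= /negP.
move=> xT; apply/setP => s; have := xT s Logic.I; rewrite /B.
by case: ifPn => //= _ /negP/negbTE.
Qed.

Lemma own_residue_mem x : Omega x -> own_residue x \in orbit_residues x.
Proof.
move=> Ox; apply/orbit_residuesP; exists (x - redM x); split => //.
  by apply/latticeP; exists (zfloor M x); rewrite -[X in X - _](redK M x) addrAC subrr add0r.
by rewrite addrC subrK.
Qed.

Lemma card_orbit_residues x F : is_good Omega M k v n' (redM x) F ->
  #|orbit_residues x| = k.
Proof.
move=> gF; rewrite -(card_residues gF); congr #|pred_of_set _|.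
apply/setP => s; apply/orbit_residuesP/idP => [[l [Ll Ol <-]]|].
  rewrite inE; apply/mapP; exists l => //.
  have [SF _ _] := gF; suff : [set` F] l by [].
  by rewrite -SF.
rewrite inE => /mapP[l lF ->]; exists l; have [SF _ _] := gF.
have [Ll Ol] : lattice_section M Omega (redM x) l by rewrite SF.
by split.
Qed.

(* Interpolating at the roots of unity indexed by [T] isolates, among the
   translates met by the orbit of [x], the one of residue [s]. *)
Lemma indicator_piece (A : set E) (s : 'I_n) (T : {set 'I_n}) :
  measurable A -> A `<=` Omega ->
  (forall x, A x -> own_residue x = s /\ orbit_residues x = T) ->
  cspan (fun x => rc (\1_A x)).
Proof.
move=> mA AO AsT.
have mA1 : cmeas Omega (fun x : E => rc (\1_A x)).
  by apply: cmeas_real; exact: measurable_indic.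
have FF := ae_filter_ringOfSetsType (@leb R d : {measure set E -> \bar R}).
(* If [T] does not have [k] elements or misses [s], no good point lies in [A], so [A] is null and
   its indicator is almost everywhere 0. *)
have [[Tk sT]|nT] := pselect (#|T| = k /\ s \in T); last first.
  have s0 : cspan (fun=> 0).
    by apply: (lin_closed_span mOmega esL2); exists [::]; apply/funext => x; rewrite big_nil.
  apply: (closed_span_ae mOmega esL2 s0 mA1).
  apply: (@filterS _ _ FF _ _ _ red_good) => x [F gF] Ox.
  rewrite indicE memNset ?rmorph0 // => Ax; apply: nT.
  have [<- <-] := AsT x Ax; split; first exact: card_orbit_residues gF.
  exact: own_residue_mem.
have [c cP] := interpolation (@root_node_inj R n') Tk sT.
(* The union of the lattice translates of [A], evaluated below at the representative of [x]. *)
pose P : set E := \bigcup_z [set w : V | A (lat M z + w)].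
have mP : measurable P.
  by apply: measurable_bigcup_lattice => z; exact: measurable_shift.
(* The factor with [- a j] cancels the character of [a j] at the representative; only its value at
   the lattice part of [x] remains, a power of the node of [own_residue x]. *)
pose w (j : 'I_k) (y : E) : C := c j * (rc (\1_P y) * e (dot (- a j) y)).
have H0 : dual_lattice L 0.
  by move=> l _; rewrite /dot big1 // => i _; rewrite mxE mul0r.
pose g0 j : I := (exist _ 0 (mem_set H0), j).
have mw j : multiplier leb Omega es (fun x => w j (redM x)).
  apply: (@multiplier_red R d Omega M k a mOmega Omega_fin M_unit D_fin (w j) (sqmod (c j))).
    apply: cmeasM; first exact: cmeas_cst.
    apply: cmeasM; last exact: cmeas_exp_dot.
    by apply: cmeas_real; exact: measurable_indic.
  move=> y; rewrite !sqmodM sqmodC sqmod_expi2pi mulr1 indicE.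
  by case: (_ \in _); rewrite ?expr1n ?expr0n ?mulr1 ?mulr0 ?sqmod_ge0.
have sg : cspan (fun x => \sum_j w j (redM x) * es (g0 j) x).
  apply: (closed_span_sum mOmega esL2) => j; have [_ _] := mw j; apply.
  apply: (lin_closed_span mOmega esL2); exists [:: (1, g0 j)].
  by apply/funext => x; rewrite big_seq1 mul1r.
apply: (closed_span_ae mOmega esL2 sg mA1).
apply: (@filterS _ _ FF _ _ _ red_good) => x [F gF] Ox.
have Lx : L (x - redM x).
  by apply/latticeP; exists (zfloor M x); rewrite -[X in X - _](redK M x) addrAC subrr add0r.
have termE j : w j (redM x) * es (g0 j) x =
    rc (\1_P (redM x)) * (c j * root_node R (own_residue x) ^+ j).
  rewrite /w /own_residue -(@expi2pi_residue R d M v n' dual_v _ Lx) -expi2piMn /exp_system /= addr0.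
  rewrite (_ : _ *+ j = dot (- a j) (redM x) + dot (a j) x).
    by rewrite expi2piD; ring.
  by rewrite -[LHS]mulr_natl dotDr dotNr dotNl /freq !dotZl; ring.
rewrite (eq_bigr _ (fun j _ => termE j)) -mulr_sumr.
have [Px|nP] := pselect (P (redM x)); last first.
  rewrite [in RHS]indicE (memNset nP) mul0r indicE memNset ?rmorph0 // => Ax.
  apply: nP; exists (zfloor M x) => //=.
  by rewrite addrC redK.
rewrite [in RHS]indicE (mem_set Px) rmorph1 mul1r.
case: Px => z _ /= Az; have [oz rz] := AsT _ Az.
have Lz := lattice_lat M z.
have redz : redM (lat M z + redM x) = redM x.
  by rewrite addrC red_lattice // redE //; exact: red_fund.
have {}oz : res (lat M z) = s.
  by rewrite -oz /own_residue redz addrK.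
have {}rz : orbit_residues x = T.
  by rewrite -rz /orbit_residues redz.
rewrite cP; last by rewrite -rz own_residue_mem.
have -> : \1_A x = (own_residue x == s)%:R :> R; last by rewrite rmorph_nat.
rewrite indicE; suff -> : (x \in A) = (own_residue x == s) by [].
apply/idP/eqP => [/set_mem Ax|xs].
  by have [] := AsT x Ax.
(* Two points of [Omega] on the same good fibre with the same residue coincide, so [x] is the point
   of [A] found on its fibre. *)
have [SF _ inj] := gF; apply/mem_set.
suff lx : x - redM x = lat M z.
  by rewrite -(subrK (redM x) x) lx.
apply: inj; last by rewrite oz.
  suff : [set` F] (x - redM x) by [].
  by rewrite -SF; split => //; rewrite addrC subrK.
suff : [set` F] (lat M z) by [].
by rewrite -SF; split => //; rewrite addrC; exact: AO.
Qed.

(** There are finitely many pairs formed by a residue and a set of residues; they cut [A] into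
    finitely many pieces to which [indicator_piece] applies. *)
Lemma indicator_closed_span (A : set E) : measurable A -> A `<=` Omega ->
  cspan (fun x => rc (\1_A x)).
Proof.
move=> mA AO.
pose B (s : 'I_n) (T : {set 'I_n}) : set E :=
  A `&` ([set x : V | own_residue x = s] `&` [set x : V | orbit_residues x = T]).
rewrite (_ : (fun _ => _) = fun x => \sum_s \sum_T rc (\1_(B s T) x)).
  apply: (closed_span_sum mOmega esL2) => s; apply: (closed_span_sum mOmega esL2) => T.
  apply: (@indicator_piece (B s T) s T).
  - apply: measurableI; first exact: mA.
    by apply: measurableI; [exact: measurable_own_residue|exact: measurable_orbit_residues].
  - by move=> x [/AO].
  - by move=> x [_ []].
apply/funext => x; rewrite (bigD1 (own_residue x)) //= (bigD1 (orbit_residues x)) //=.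
rewrite big1 => [|T nT]; last first.
  by rewrite indicE memNset ?rmorph0 // => -[_ [_ /= xT]]; rewrite xT eqxx in nT.
rewrite big1 => [|s ns]; last first.
  rewrite big1 // => T _.
  by rewrite indicE memNset ?rmorph0 // => -[_ [/= xs _]]; rewrite xs eqxx in ns.
rewrite !addr0 !indicE.
suff -> : (x \in A) = (x \in B (own_residue x) (orbit_residues x)) by [].
by apply/idP/idP => /set_mem; [move=> Ax|case=> Ax _]; apply/mem_set.
Qed.

Lemma closed_span_bounded (phi : E -> R) K : measurable_fun setT phi ->
  (forall x, `|phi x| <= K) -> cspan (fun x => rc (phi x * \1_Omega x)).
Proof.
move=> mphi phiK.
have O2 : L2 leb Omega (fun x => rc (\1_Omega x)).
  exact: (closed_span_L2 (indicator_closed_span mOmega (@subset_refl _ Omega))).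
(* Measurability is carried along because the passage to the limit by dominated convergence uses
   it. *)
pose P (f : E -> R) := measurable_fun setT f /\ cspan (fun x => rc (f x * \1_Omega x)).
suff [] : P phi by [].
apply: (@bounded_measurable_ind R _ E P _ _ _ _ phi K mphi phiK).
- move=> A mA; split; first exact: measurable_indic.
  rewrite (_ : (fun _ => _) = fun x => rc (\1_(A `&` Omega) x)).
    by apply: indicator_closed_span; [exact: measurableI|exact: subIsetr].
  by apply/funext => x; rewrite indicI.
- move=> f g [mf sf] [mg sg]; split; first exact: measurable_funD.
  rewrite (_ : (fun _ => _) =
      fun x => rc (f x * \1_Omega x) + rc (g x * \1_Omega x)).
    exact: (closed_spanD mOmega esL2 sf sg).
  by apply/funext => x; rewrite mulrDl rmorphD.
- move=> c f [mf sf]; split.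
    by apply: measurable_funM; [exact: measurable_cst|exact: mf].
  rewrite (_ : (fun _ => _) = fun x => rc c * rc (f x * \1_Omega x)).
    exact: (closed_spanZ mOmega esL2 _ sf).
  by apply/funext => x; rewrite -mulrA rmorphM.
- move=> f_ f K' sf_ fK ff; split.
    by apply: (measurable_fun_cvg (fun m => (sf_ m).1)) => x _; exact: ff.
  rewrite (_ : (fun _ => _) = fun x => rc (f x) * rc (\1_Omega x)); last first.
    by apply/funext => x; rewrite rmorphM.
  apply: (closed_span_dominated mOmega esL2 O2 _ fK ff).
    by move=> m; apply: measurable_funTS; exact: (sf_ m).1.
  move=> m; have := (sf_ m).2; congr cspan.
  by apply/funext => x; rewrite rmorphM.
Qed.

(** After extension by 0 outside [Omega], the function is truncated to where its modulus is at most
    [m]; the truncations are bounded and converge to it under domination. *)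
Lemma closed_span_real (r : E -> R) : L2 leb Omega (fun x => rc (r x)) ->
  cspan (fun x => rc (r x)).
Proof.
move=> r2; have [[mr _] _] := r2.
pose u : E -> R := r \_ Omega.
have mu : measurable_fun setT u by apply/(measurable_restrictT _ mOmega).
have uE x : Omega x -> r x = u x by move=> Ox; rewrite /u patchE mem_set.
have u2 : L2 leb Omega (fun x => rc (u x)).
  split; first by apply: cmeas_real; exact: measurable_funTS mu.
  rewrite -(@nrm2_eq _ _ _ _ _ (fun x => rc (r x))); first by case: r2.
  by move=> x Ox; rewrite uE.
have su : cspan (fun x => rc (u x)).
  pose w m (x : E) : R := \1_[set y | `|u y| <= m%:R] x.
  have mset m : measurable ([set y | `|u y| <= m%:R] : set E).
    rewrite (_ : mkset _ = (fun y => `|u y|) @^-1` `]-oo, m%:R]%classic).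
      rewrite -[X in measurable X]setTI.
      have mnu : measurable_fun setT (fun y => `|u y|).
        apply: (@measurableT_comp _ _ _ E _ _ (fun s : R => `|s|)).
          exact: normr_measurable.
        exact: mu.
      by apply: mnu => //; exact: measurable_itv.
    by apply/seteqP; split => x /=; rewrite in_itv.
  have mw m : measurable_fun setT (w m) by exact: measurable_indic.
  rewrite (_ : (fun _ => _) = fun x => rc 1 * rc (u x)); last first.
    by apply/funext => x; rewrite rmorph1 mul1r.
  apply: (closed_span_dominated (w_ := w) (w := fun=> 1) (K := 1) mOmega esL2 u2).
  - by move=> m; exact: measurable_funTS (mw m).
  - by move=> m x; rewrite /w indicE normr_nat lern1 leq_b1.
  - move=> x; apply: cvg_near_cst; near=> m.
    rewrite /w indicE mem_set //=.
    near: m; exact: nbhs_infty_ger.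
  move=> m; have := @closed_span_bounded (fun x => w m x * u x) m%:R.
  rewrite (_ : (fun x => rc (w m x * u x * \1_Omega x)) = fun x => rc (w m x) * rc (u x)).
    apply; first exact: measurable_funM.
    move=> x; rewrite normrM /w indicE normr_nat.
    by case: (boolP (_ \in _)) => [/set_mem /= ux|_]; rewrite ?mul1r ?mul0r.
  apply/funext => x; rewrite -rmorphM -mulrA; congr (rc (_ * _)).
  by rewrite /u patchE indicE; case: (_ \in _); rewrite ?mulr1 ?mulr0.
apply: (closed_span_ae mOmega esL2 su (cmeas_real mr)).
by apply: aeW => x Ox; rewrite uE.
Unshelve. all: by end_near. Qed.

Lemma L2_closed_span (f : E -> C) : L2 leb Omega f -> cspan f.
Proof.
move=> [[mr mi] f2].
have part (r : E -> R) : measurable_fun Omega r ->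
    (forall x, r x ^+ 2 <= sqmod (f x)) -> cspan (fun x => rc (r x)).
  move=> mr' rf; apply: closed_span_real; split; first exact: cmeas_real.
  apply: le_lt_trans f2; apply: (ge0_le_integral _ mOmega).
  - by move=> x _; rewrite lee_fin sqmod_ge0.
  - by apply: measurable_esqmod; exact: cmeas_real.
  - by apply: measurable_esqmod.
  - by move=> x _; rewrite lee_fin sqmodC rf.
have sr : cspan (fun x => rc (complex.Re (f x))).
  by apply: part => // x; rewrite sqmodE lerDl sqr_ge0.
have si : cspan (fun x => rc (complex.Im (f x))).
  by apply: part => // x; rewrite sqmodE lerDr sqr_ge0.
rewrite (_ : f = fun x => rc (complex.Re (f x)) +
    Complex 0 1 * rc (complex.Im (f x))).
  exact: (closed_spanD mOmega esL2 sr (closed_spanZ mOmega esL2 _ si)).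
apply/funext => x; case: (f x) => s t.
by apply/eqP; rewrite eq_complex /=; apply/andP; split; apply/eqP; ring.
Qed.

End density.

(** * Collecting finite combinations, countability of the index set, and the Riesz basis *)

Section finite_combinations.
Import complex.
Context (R : realType) d (T : measurableType d) (I : choiceType).
Local Notation C := R[i].
Implicit Types e : I -> T -> C.

(** Coefficients of equal indices in the list are added up, since completeness asks for sums over
    finite sets of indices. *)
Lemma lin_span_fcomb e f : lin_span e f ->
  exists (F : {fset I}) c, f = fcomb e c F.
Proof.
move=> [s ->]; exists [fset p.2 | p in s]%fset.
exists (fun g => \sum_(p <- s | p.2 == g) p.1); apply/funext => x.
rewrite /fcomb; under [RHS]eq_bigr do rewrite mulr_suml.
rewrite (exchange_big_dep predT) //= big_seq [RHS]big_seq.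
apply: eq_bigr => p ps; rewrite (big_rem p.2) /=; last first.
  by apply/imfsetP; exists p.
rewrite eqxx big1_seq ?addr0 // => g /andP[/eqP <-].
by rewrite mem_rem_uniq ?fset_uniq // inE eqxx.
Qed.

End finite_combinations.

(** A dual vector is determined by its pairings with the columns of [M], which form an integer
    vector. *)
Lemma countable_dual_lattice (R : realType) (d k : nat) (M : 'M[R]_d) :
  M \in unitmx -> countable [set: dual_lattice (lattice M) * 'I_k].
Proof.
move=> M_unit; apply/countable_injP.
pose f (g : dual_lattice (lattice M) * 'I_k) : nat := choice.pickle
  ((\col_i Num.floor ((M^T *m val g.1) i 0) : 'cV[int]_d), g.2).
exists f => g g' _ _ /(pcan_inj (@choice.pickleK _)) [] /colP gg' g2.
have intM (h : dual_lattice (lattice M)) i : (M^T *m val h) i 0 \is a Num.int.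
  have /set_mem /(_ (lat M (delta_mx i 0)) (lattice_lat _ _)) := valP h.
  congr (_ \is a Num.int); rewrite /lat /dot mxE.
  apply: eq_bigr => j _; rewrite !mxE mulrC (bigD1 i) //= big1 => [|l li].
    by rewrite !mxE !eqxx mulr1 addr0 mulrC.
  by rewrite !mxE (negbTE li) mulr0.
have MT : M^T *m val g.1 = M^T *m val g'.1.
  apply/matrixP => i j; rewrite ord1; have := gg' i; rewrite [LHS]mxE [RHS]mxE => fl.
  by rewrite -(floorK (intM g.1 i)) fl (floorK (intM g'.1 i)).
case: g g' MT g2 {gg'} => [h j] [h' j'] /= MT ->; congr pair; apply/val_inj.
by apply: (can_inj (mulKmx (_ : M^T \in unitmx)) MT); rewrite unitmx_tr.
Qed.

Theorem theorem1p1 (R : realType) (d : nat) (Omega : set (euclid R d))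
  (M : 'M[R]_d) (k : nat)
  (mOmega : measurable Omega)
  (Omega_gt0 : (0 < leb Omega)%E) (Omega_fin : (leb Omega < +oo)%E)
  (M_unit : M \in unitmx) (k_gt0 : (0 < k)%N)
  (tiling : multi_tiles M Omega k)
  (adm : admissible M Omega) :
  exists a : 'I_k -> 'cV[R]_d,
    riesz_basis Omega (exp_system (H := dual_lattice (lattice M)) a).
Proof.
have [v [n [dual_v n_gt0 v_sep]]] := adm.
case: n n_gt0 v_sep => [//|n'] _ v_sep.
exists (@freq R d k v n').
set es := exp_system _.
have esL2 g : L2 leb Omega (es g) by exact: (exp_system_L2 _ g mOmega Omega_fin).
(* Both predicates have the same three clauses, grouped differently. *)
have inL2E f : L2 leb Omega f <-> inL2 Omega f.
  by split=> [[[? ?] ?]|[? ? ?]].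
have [A0 [K [A00 K0 frame]]] := exp_system_frame mOmega Omega_gt0 Omega_fin
  M_unit k_gt0 tiling dual_v v_sep.
split.
- exact: countable_dual_lattice.
- by move=> g; apply/inL2E.
- move=> f /inL2E f2 eps eps0.
  have [_ /(_ eps eps0)[g /lin_span_fcomb[F [c ->]] fg]] :=
    L2_closed_span mOmega Omega_fin M_unit k_gt0 tiling dual_v v_sep f2.
  by exists F, c.
(* The frame bounds of finite combinations, with the factors 2 lost in [frame_sum]. *)
exists (A0 / 2), (2 * K); split; [by rewrite divr_gt0|by rewrite mulr_gt0|].
move=> c cfin.
have [S [S2 sumS lo hi]] := frame_sum mOmega esL2 A00 K0 frame cfin.
by exists S; split; [exact/inL2E|exact: sumS|exact: lo|exact: hi].
Qed.
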